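(* Let $\Gamma$ be a finite simple graph, $A_\Gamma$ the associated right-angled Artin group, and $\phi\in\mathrm{Aut}(A_\Gamma)$ a length-preserving automorphism of finite order $m$. Then the conjugacy problem is solvable for the group $$A_\phi = A_\Gamma \rtimes_\phi \mathbb{Z}/m\mathbb{Z} = \langle V(\Gamma), t \mid [s,s']=1 \ (\{s,s'\}\in E(\Gamma)),\ t^m = 1,\ t^{-1}xt = \phi(x)\ (x\in V(\Gamma))\rangle.$$
   Context: The right-angled Artin group of $\Gamma$ is $A_\Gamma = \langle V(\Gamma) \mid [s,t]=1 \text{ for all } \{s,t\}\in E(\Gamma)\rangle$. With $X = V(\Gamma)\cup V(\Gamma)^{-1}$ and $|g|$ the word length of $g$ over $X$, $\phi$ is length-preserving if $|\phi(g)|=|g|$ for all $g\in A_\Gamma$. The conjugacy problem for a finitely presented group $G$ with generating set $Y$ asks for an algorithm that, given two words over $Y\cup Y^{-1}$, decides whether they represent conjugate elements of $G$. *)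

(* Defs.v *)
From Stdlib Require Import Relation_Operators.
From mathcomp Require Import all_boot.
Set Implicit Arguments. Unset Strict Implicit. Unset Printing Implicit Defensive.

(* A letter (a, b) denotes the generator a if b = false and a^-1 if b = true. *)
Definition inv_letter {A : Type} (x : A * bool) : A * bool := (x.1, ~~ x.2).
Definition inv_word {A : Type} (w : seq (A * bool)) : seq (A * bool) :=
  rev (map inv_letter w).

(* Group presentation <A | R>: equality of words in the presented group is the
   equivalence closure of inserting (anywhere) a relator from R or a trivial
   word x x^-1. *)
Definition rel_or_trivial {A : Type} (R : seq (A * bool) -> Prop)
  (r : seq (A * bool)) : Prop :=
  R r \/ exists x, r = [:: x; inv_letter x].

Inductive pstep {A : Type} (R : seq (A * bool) -> Prop) :
  seq (A * bool) -> seq (A * bool) -> Prop :=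
| pstep_ins u v r : rel_or_trivial R r -> pstep R (u ++ v) (u ++ r ++ v).

Definition pres_eq {A : Type} (R : seq (A * bool) -> Prop) :
  seq (A * bool) -> seq (A * bool) -> Prop :=
  clos_refl_sym_trans _ (pstep R).

Definition raag_rels (n : nat) (e : rel 'I_n) (r : seq ('I_n * bool)) : Prop :=
  exists s s', e s s' /\
    r = [:: (s, false); (s', false); (s, true); (s', true)].

Definition raag_eq (n : nat) (e : rel 'I_n) := pres_eq (raag_rels e).

Definition is_word_length (n : nat) (e : rel 'I_n) (w : seq ('I_n * bool))
  (k : nat) : Prop :=
  (exists w', raag_eq e w w' /\ size w' = k) /\
  (forall w', raag_eq e w w' -> k <= size w').

Definition phi_word (n : nat) (phi : 'I_n -> seq ('I_n * bool))
  (w : seq ('I_n * bool)) : seq ('I_n * bool) :=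
  flatten (map (fun x => if x.2 then inv_word (phi x.1) else phi x.1) w).

Definition is_raag_aut (n : nat) (e : rel 'I_n)
  (phi : 'I_n -> seq ('I_n * bool)) : Prop :=
  [/\ (forall u v, raag_eq e u v -> raag_eq e (phi_word phi u) (phi_word phi v)),
      (forall u v, raag_eq e (phi_word phi u) (phi_word phi v) -> raag_eq e u v)
    & (forall v, exists u, raag_eq e (phi_word phi u) v)].

Definition length_preserving (n : nat) (e : rel 'I_n)
  (phi : 'I_n -> seq ('I_n * bool)) : Prop :=
  forall w k, is_word_length e (phi_word phi w) k <-> is_word_length e w k.

Definition aut_order (n : nat) (e : rel 'I_n)
  (phi : 'I_n -> seq ('I_n * bool)) (m : nat) : Prop :=
  [/\ 0 < m,
      (forall w, raag_eq e (iter m (phi_word phi) w) w)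
    & (forall k, 0 < k < m -> exists w, ~ raag_eq e (iter k (phi_word phi) w) w)].

(* Generators: Some s for s in V(Gamma), None for t. *)
Definition emb_word (n : nat) (w : seq ('I_n * bool)) : seq (option 'I_n * bool) :=
  map (fun x => (Some x.1, x.2)) w.

Definition aphi_rels (n : nat) (e : rel 'I_n) (phi : 'I_n -> seq ('I_n * bool))
  (m : nat) (r : seq (option 'I_n * bool)) : Prop :=
  (exists s s', e s s' /\
     r = [:: (Some s, false); (Some s', false); (Some s, true); (Some s', true)])
  \/ r = nseq m (None, false)
  \/ (exists x, r = [:: (None, true); (Some x, false); (None, false)]
                      ++ inv_word (emb_word (phi x))).

Definition aphi_eq (n : nat) (e : rel 'I_n) (phi : 'I_n -> seq ('I_n * bool))
  (m : nat) := pres_eq (aphi_rels e phi m).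

Definition conjugate {L : Type} (eqg : seq (L * bool) -> seq (L * bool) -> Prop)
  (u v : seq (L * bool)) : Prop :=
  exists z, eqg (inv_word z ++ u ++ z) v.

Inductive recf : Type :=
| RZero : recf
| RSucc : recf
| RProj : nat -> recf
| RComp : recf -> list recf -> recf
| RPrec : recf -> recf -> recf
| RMu   : recf -> recf.

Inductive reval : recf -> seq nat -> nat -> Prop :=
| ev_zero xs : reval RZero xs 0
| ev_succ x xs : reval RSucc (x :: xs) x.+1
| ev_proj i xs : i < size xs -> reval (RProj i) xs (nth 0 xs i)
| ev_comp f gs xs ys y : revals gs xs ys -> reval f ys y -> reval (RComp f gs) xs y
| ev_prec0 f g xs y : reval f xs y -> reval (RPrec f g) (0 :: xs) y
| ev_precS f g k xs y z : reval (RPrec f g) (k :: xs) y ->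
    reval g (k :: y :: xs) z -> reval (RPrec f g) (k.+1 :: xs) z
| ev_mu f xs k : reval f (k :: xs) 0 ->
    (forall j, j < k -> exists v, v <> 0 /\ reval f (j :: xs) v) ->
    reval (RMu f) xs k
with revals : list recf -> seq nat -> seq nat -> Prop :=
| evs_nil xs : revals nil xs [::]
| evs_cons g gs xs y ys : reval g xs y -> revals gs xs ys ->
    revals (cons g gs) xs (y :: ys).

(* Fixed computable injective encoding of words over option 'I_n x bool. *)
Definition cantor_pair (a b : nat) : nat := ((a + b) * (a + b).+1) %/ 2 + b.
Definition code_letter (n : nat) (x : option 'I_n * bool) : nat :=
  match x.1 with None => x.2 | Some i => (i.+1).*2 + x.2 end.
Definition code_word (n : nat) (w : seq (option 'I_n * bool)) : nat :=
  foldr (fun x acc => (cantor_pair (code_letter x) acc).+1) 0 w.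

Definition conjugacy_problem_solvable (n : nat)
  (eqg : seq (option 'I_n * bool) -> seq (option 'I_n * bool) -> Prop) : Prop :=
  exists f : recf, forall u v,
    (conjugate eqg u v -> reval f [:: code_word u; code_word v] 1) /\
    (~ conjugate eqg u v -> reval f [:: code_word u; code_word v] 0).

(* Main.v *)
(** Left multiplication with free cancellation is an action of [A_Gamma] on
reduced words up to commutation, so the normal form is unique, and [A_phi] acts
likewise on pairs [(a, l)] standing for [t^a l], because a length-preserving
automorphism permutes the letters. This decides the word problem.

Conjugacy of [t^a u] and [t^b v] in [A_phi] means [a = b] and
[psi(z) u = phi^k(v) z] for some [k < m] and [z], where [psi = phi^a]. Let [z_i]
be the part of [z] of height less than [i] in its heap of pieces (Foata normal
form). Truncation commutes with [psi], changes by at most one letter under a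
left multiplication by a letter and by at most [n + 1] under a right one, so
[psi(z_i) u = E_i z_i] with [|E_i|] bounded in terms of [u] and [v]. If
[E_i = E_j] with [i < j], the slice of [z] between heights [i] and [j] can be cut
out, so the shortest [z] has computably bounded length, and searching all
conjugators up to that bound decides conjugacy. *)
Require Import Defs.
From Stdlib Require Import Relation_Operators Setoid Morphisms.
From mathcomp Require Import all_boot zify.
Set Implicit Arguments. Unset Strict Implicit. Unset Printing Implicit Defensive.

(** * Recursive functions *)

(** Lists stand for argument tuples, so only those of length [k] matter. *)
Definition computable k (F : seq nat -> nat) :=
  exists r, forall xs, size xs = k -> reval r xs (F xs).

Lemma computable_ext k F G :
  (forall xs, size xs = k -> F xs = G xs) -> computable k F -> computable k G.
Proof. by move=> E [r Hr]; exists r => xs sxs; rewrite -E //; exact: Hr. Qed.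

Lemma computable_nth k i : i < k -> computable k (fun xs => nth 0 xs i).
Proof. by move=> ik; exists (RProj i) => xs sxs; constructor; rewrite sxs. Qed.

Lemma revals_map k (Gs : seq (seq nat -> nat)) :
  (forall i, i < size Gs -> computable k (nth (fun=> 0) Gs i)) ->
  exists rs, forall xs, size xs = k -> revals rs xs (map (fun G => G xs) Gs).
Proof.
elim: Gs => [|G Gs IH] H; first by exists nil => xs _; constructor.
have [r Hr] := H 0 isT; have [rs Hrs] := IH (fun i => H i.+1).
by exists (cons r rs) => xs sxs; constructor; [exact: Hr|exact: Hrs].
Qed.

Lemma computable_comp k F (Gs : seq (seq nat -> nat)) :
  computable (size Gs) F ->
  (forall i, i < size Gs -> computable k (nth (fun=> 0) Gs i)) ->
  computable k (fun xs => F (map (fun G => G xs) Gs)).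
Proof.
move=> [r Hr] /revals_map[rs Hrs]; exists (RComp r rs) => xs sxs.
by apply: ev_comp (Hrs xs sxs) _; apply: Hr; rewrite size_map.
Qed.

Lemma computable_const k c : computable k (fun=> c).
Proof.
elim: c => [|c [r Hr]]; first by exists RZero => xs _; constructor.
exists (RComp RSucc (cons r nil)) => xs sxs.
by apply: (@ev_comp _ _ _ [:: c]); [constructor; [exact: Hr|constructor]|constructor].
Qed.

(** * Arithmetic, case distinction and bounded search *)

Definition computable1 (h : nat -> nat) := computable 1 (fun xs => h (nth 0 xs 0)).
Definition computable2 (h : nat -> nat -> nat) :=
  computable 2 (fun xs => h (nth 0 xs 0) (nth 0 xs 1)).
Lemma comp1 h k F : computable1 h -> computable k F -> computable k (fun xs => h (F xs)).
Proof.
move=> Hh HF; apply: (computable_comp (Gs := [:: F]) Hh).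
by case.
Qed.

Lemma comp2 h k F G : computable2 h -> computable k F -> computable k G ->
  computable k (fun xs => h (F xs) (G xs)).
Proof.
move=> Hh HF HG; apply: (computable_comp (Gs := [:: F; G]) Hh).
by case=> [|[|]].
Qed.

Fixpoint prec (b : nat) (s : nat -> nat -> nat) (k : nat) : nat :=
  if k is k'.+1 then s k' (prec b s k') else b.

(** [RPrec] puts the counter and the previous value in front of the parameters, so the step function
    finds its parameters at [drop 2]. *)
Lemma computable_prec k B s N :
  computable k B -> computable k N ->
  computable k.+2 (fun ys => s (nth 0 ys 0) (nth 0 ys 1) (drop 2 ys)) ->
  computable k (fun xs => prec (B xs) (fun j y => s j y xs) (N xs)).
Proof.
move=> [b Hb] HN [r Hr].
pose F ys := prec (B (behead ys)) (fun j y => s j y (behead ys)) (nth 0 ys 0).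
have HF : computable k.+1 F.
  exists (RPrec b r) => -[//|j xs] [sxs]; rewrite /F /=.
  elim: j => [|j IH] /=; first by constructor; exact: Hb.
  apply: ev_precS IH _; have := Hr [:: j, prec (B xs) (fun j y => s j y xs) j & xs].
  by rewrite /= drop0 sxs; exact.
pose Gs := N :: [seq (fun xs => nth 0 xs i) | i <- iota 0 k].
have sGs : size Gs = k.+1 by rewrite /= size_map size_iota.
apply: (computable_ext (F := fun xs => F (map (fun G => G xs) Gs))).
  move=> xs sxs; rewrite /F /= -map_comp (_ : map _ _ = xs) //.
  by rewrite -[RHS](mkseq_nth 0) sxs.
apply: computable_comp; rewrite ?sGs // => -[//|i]; rewrite ltnS /= => ik.
by rewrite (nth_map 0) ?size_iota // nth_iota //; exact: computable_nth.
Qed.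

Lemma computable_nth_drop k d i : d + i < k -> computable k (fun xs => nth 0 (drop d xs) i).
Proof.
move=> H; apply: computable_ext (computable_nth H) => xs _; by rewrite nth_drop.
Qed.

Lemma computable_succ : computable1 succn.
Proof. by exists RSucc => -[|x [|]] // _; constructor. Qed.

Ltac comput := repeat first
  [ apply: computable_const
  | by apply: computable_nth
  | by apply: computable_nth_drop
  | apply: (comp1 computable_succ) ].

Lemma computable_pred : computable1 predn.
Proof.
apply: (computable_ext (F := fun xs => prec 0 (fun j y => j) (nth 0 xs 0))).
  by move=> xs _; case: (nth 0 xs 0).
by apply: (computable_prec (s := fun j _ _ => j)); comput.
Qed.

Lemma computable_add : computable2 addn.
Proof.
apply: (computable_ext (F := fun xs => prec (nth 0 xs 0) (fun j y => y.+1) (nth 0 xs 1))).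
  by move=> xs _; elim: (nth 0 xs 1) => [|k /= ->]; rewrite ?addn0 ?addnS.
by apply: (computable_prec (s := fun _ y _ => y.+1)); comput.
Qed.

Lemma computable_sub : computable2 subn.
Proof.
apply: (computable_ext (F := fun xs => prec (nth 0 xs 0) (fun j y => y.-1) (nth 0 xs 1))).
  by move=> xs _; elim: (nth 0 xs 1) => [|k /= ->]; rewrite ?subn0 ?subnS.
apply: (computable_prec (s := fun _ y _ => y.-1)); comput.
by apply: (comp1 computable_pred); comput.
Qed.

Lemma computable_mul : computable2 muln.
Proof.
apply: (computable_ext (F := fun xs => prec 0 (fun j y => nth 0 xs 0 + y) (nth 0 xs 1))).
  by move=> xs _; elim: (nth 0 xs 1) => [|k /= ->]; rewrite ?muln0 ?mulnS.
apply: (computable_prec (s := fun _ y xs => nth 0 xs 0 + y)); comput.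
by apply: (comp2 computable_add); comput.
Qed.

Lemma computable_eq : computable2 (fun x y => x == y).
Proof.
apply: (computable_ext (F := fun xs =>
    1 - ((nth 0 xs 0 - nth 0 xs 1) + (nth 0 xs 1 - nth 0 xs 0)))).
  by move=> xs _; case: eqP; lia.
by do ![apply: (comp2 computable_sub)|apply: (comp2 computable_add)|comput].
Qed.

Lemma computable_lt : computable2 (fun x y => x < y).
Proof.
apply: (computable_ext (F := fun xs => 1 - ((nth 0 xs 0).+1 - nth 0 xs 1))).
  by move=> xs _; case: ltnP; lia.
by do ![apply: (comp2 computable_sub)|comput].
Qed.

Lemma computable_if k (b : seq nat -> bool) F G :
  computable k (fun xs => b xs) -> computable k F -> computable k G ->
  computable k (fun xs => if b xs then F xs else G xs).
Proof.
move=> Hb HF HG.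
apply: (computable_ext (F := fun xs => b xs * F xs + (1 - b xs) * G xs)).
  by move=> xs _; case: (b xs); rewrite ?mul1n ?mul0n ?addn0.
apply: (comp2 computable_add); apply: (comp2 computable_mul) => //.
by apply: (comp2 computable_sub); comput.
Qed.

Lemma computable_has k (P : nat -> seq nat -> bool) N :
  computable k.+1 (fun ys => P (nth 0 ys 0) (drop 1 ys)) -> computable k N ->
  computable k (fun xs => has (P^~ xs) (iota 0 (N xs))).
Proof.
move=> HP HN.
apply: (computable_ext (F := fun xs => prec 0
          (fun j y => if P j xs then 1 else y) (N xs))).
  move=> xs _; elim: (N xs) => [|j IH] //.
  by rewrite -[in RHS](addn1 j) iotaD has_cat /= orbF IH add0n orbC; case: (P j xs).
apply: (computable_prec (s := fun j y xs => if P j xs then 1 else y)); comput => //.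
apply: (computable_if (b := fun ys => P (nth 0 ys 0) (drop 2 ys))); comput.
(* The test expects the counter directly followed by the parameters, so the accumulator in position
   1 is skipped. *)
pose Gs := (fun ys => nth 0 ys 0) :: [seq (fun ys => nth 0 ys i.+2) | i <- iota 0 k].
apply: (computable_ext (F := fun ys => P (nth 0 (map (fun G => G ys) Gs) 0)
                                      (drop 1 (map (fun G => G ys) Gs)))).
  move=> [//|x [//|y ys]] [sys]; rewrite /= -map_comp drop0; congr (nat_of_bool (P _ _)).
  by rewrite drop0 -[RHS](mkseq_nth 0) sys.
have sGs : size Gs = k.+1 by rewrite /= size_map size_iota.
apply: (computable_comp (F := fun ys => P (nth 0 ys 0) (drop 1 ys))); rewrite ?sGs //.
move=> [|i] ik; first by comput.
by rewrite /= (nth_map 0) ?size_iota // nth_iota //; exact: computable_nth.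
Qed.

(** Finite data are hard-wired one value at a time. This is how the graph and the letter
    permutation, given as arbitrary functions, enter recursive functions. *)
Lemma computable_table1 N (h : nat -> nat) :
  exists2 g, computable1 g & forall i, i < N -> g i = h i.
Proof.
elim: N => [|N [g Hg E]]; first by exists (fun=> 0) => //; exact: computable_const.
exists (fun i => if i == N then h N else g i) => [|i].
  apply: (computable_if (b := fun xs => nth 0 xs 0 == N)); comput.
    by apply: (comp2 computable_eq); comput.
  by apply: (comp1 Hg); comput.
by rewrite ltnS leq_eqVlt; case: eqP => [->|_ /= /E].
Qed.

Lemma computable_table2 N M (h : nat -> nat -> nat) :
  exists2 g, computable2 g & forall i j, i < N -> j < M -> g i j = h i j.
Proof.
elim: N => [|N [g Hg E]]; first by exists (fun _ _ => 0) => //; exact: computable_const.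
have [t Ht Et] := computable_table1 M (h N).
exists (fun i j => if i == N then t j else g i j) => [|i j].
  apply: (computable_if (b := fun xs => nth 0 xs 0 == N)).
  - by apply: (comp2 computable_eq); comput.
  - by apply: (comp1 Ht); comput.
  - by apply: (comp2 Hg); comput.
by rewrite ltnS leq_eqVlt; case: eqP => [-> _ /Et|_ /= iN /E -> //].
Qed.

(** * The Cantor pairing and its inverses *)

Lemma computable_pair : computable2 cantor_pair.
Proof.
have tri s : prec 0 (fun j y => y + j.+1) s = (s * s.+1) %/ 2.
  elim: s => //= s ->; rewrite (_ : s.+1 * s.+2 = s.+1 * 2 + s * s.+1); last by lia.
  by rewrite divnMDl // addnC.
have Htri : computable1 (fun s => (s * s.+1) %/ 2).
  apply: (computable_ext (F := fun xs => prec 0 (fun j y => y + j.+1) (nth 0 xs 0))) => [xs _ //|].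
  apply: (computable_prec (s := fun j y _ => y + j.+1)); comput.
  by apply: (comp2 computable_add); comput.
apply: (comp2 computable_add); comput; apply: (comp1 Htri).
by apply: (comp2 computable_add); comput.
Qed.

Lemma cantor_pair_inj a b a' b' : cantor_pair a b = cantor_pair a' b' -> a = a' /\ b = b'.
Proof.
pose T s := (s * s.+1) %/ 2.
have TS s : T s.+1 = T s + s.+1.
  by rewrite /T (_ : s.+1 * s.+2 = s.+1 * 2 + s * s.+1); [rewrite divnMDl // addnC|lia].
(* The diagonal [s] occupies the interval from [T s] to [T s + s], and these intervals are
   disjoint. *)
have Tlt s s' : s < s' -> T s + s < T s'.
  elim: s' => // s' IH; rewrite ltnS leq_eqVlt TS => /predU1P[->|/IH]; lia.
rewrite /cantor_pair -/(T (a + b)) -/(T (a' + b')).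
by case: (ltngtP (a + b) (a' + b')) => [/Tlt|/Tlt|E]; rewrite ?E; lia.
Qed.

Lemma leq_pair a b : a + b <= cantor_pair a b.
Proof.
rewrite /cantor_pair; have : a + b <= (a + b) * (a + b).+1 %/ 2 + (a + b == 0) by
  case: (a + b) => // s; rewrite addn0 leq_divRL //; nia.
case: (eqVneq (a + b) 0) => [|nz]; first lia.
by rewrite addn0; lia.
Qed.

(** Inversion by exhaustive search: both components are at most [c] by [leq_pair], and injectivity
    leaves at most one hit. *)
Definition unpair1 c := prec 0
  (fun a y => if has (fun b => cantor_pair a b == c) (iota 0 c.+1) then a else y) c.+1.
Definition unpair2 c := prec 0
  (fun b y => if has (fun a => cantor_pair a b == c) (iota 0 c.+1) then b else y) c.+1.

Lemma prec_last (P : nat -> bool) i N :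
  i < N -> P i -> (forall j, P j -> j = i) ->
  prec 0 (fun j y => if P j then j else y) N = i.
Proof.
move=> + Pi uniP; elim: N => // N IH; rewrite ltnS leq_eqVlt /=.
by case: ifP => [/uniP //|PN /predU1P[eiN|/IH //]]; rewrite -eiN Pi in PN.
Qed.

Lemma pairK1 a b : unpair1 (cantor_pair a b) = a.
Proof.
have le := leq_pair a b; apply: prec_last => [||j].
- by rewrite ltnS; lia.
- by apply/hasP; exists b => //; rewrite mem_iota; lia.
- by move/hasP => [b' _ /eqP /cantor_pair_inj[]].
Qed.

Lemma pairK2 a b : unpair2 (cantor_pair a b) = b.
Proof.
have le := leq_pair a b; apply: prec_last => [||j].
- by rewrite ltnS; lia.
- by apply/hasP; exists a => //; rewrite mem_iota; lia.
- by move/hasP => [a' _ /eqP /cantor_pair_inj[]].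
Qed.

Lemma computable_unpair1 : computable1 unpair1.
Proof.
have H : computable2 (fun a c => has (fun b => cantor_pair a b == c) (iota 0 c.+1)).
  apply: (computable_has (P := fun b xs => cantor_pair (nth 0 xs 0) b == nth 0 xs 1)); comput.
  by apply: (comp2 computable_eq); comput; apply: (comp2 computable_pair); comput.
apply: (computable_prec (s := fun a y xs =>
  if has (fun b => cantor_pair a b == nth 0 xs 0) (iota 0 (nth 0 xs 0).+1) then a else y)); comput.
apply: (computable_if (b := fun ys => has (fun b => cantor_pair (nth 0 ys 0) b == _) _)); comput.
by apply: (comp2 H); comput.
Qed.

Lemma computable_unpair2 : computable1 unpair2.
Proof.
have H : computable2 (fun b c => has (fun a => cantor_pair a b == c) (iota 0 c.+1)).
  apply: (computable_has (P := fun a xs => cantor_pair a (nth 0 xs 0) == nth 0 xs 1)); comput.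
  by apply: (comp2 computable_eq); comput; apply: (comp2 computable_pair); comput.
apply: (computable_prec (s := fun b y xs =>
  if has (fun a => cantor_pair a b == nth 0 xs 0) (iota 0 (nth 0 xs 0).+1) then b else y)); comput.
apply: (computable_if (b := fun ys => has (fun a => cantor_pair a (nth 0 ys 0) == _) _)); comput.
by apply: (comp2 H); comput.
Qed.

(** * Codes of finite sequences *)

Definition cons_code x c := (cantor_pair x c).+1.
Definition seq_code (s : seq nat) := foldr cons_code 0 s.
(** A code is at least the length of its list, so the code itself is enough fuel. *)
Fixpoint decode_fuel k c : seq nat :=
  if k is k'.+1 then
    if c == 0 then [::] else unpair1 c.-1 :: decode_fuel k' (unpair2 c.-1)
  else [::].
Definition decode c := decode_fuel c c.

Lemma size_seq_code s : size s <= seq_code s.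
Proof.
elim: s => //= x s IH; rewrite /cons_code -/(seq_code s).
by have := leq_pair x (seq_code s); lia.
Qed.

Lemma seq_codeK : cancel seq_code decode.
Proof.
move=> s; suff H k : size s <= k -> decode_fuel k (seq_code s) = s.
  by apply: H; exact: size_seq_code.
elim: s k => [|x s IH] [|k] //= sk.
by rewrite pairK1 pairK2 IH.
Qed.

(** A loop whose state pairs the accumulator with the code of the unread rest. It runs [C xs]
    rounds, the fuel of [decode], and idles once the rest is 0. *)
Lemma computable_foldl k A s C :
  computable k A -> computable k C ->
  computable k.+2 (fun ys => s (nth 0 ys 0) (nth 0 ys 1) (drop 2 ys)) ->
  computable k (fun xs => foldl (fun acc x => s acc x xs) (A xs) (decode (C xs))).
Proof.
move=> HA HC [r Hr].
pose next st xs := if unpair2 st == 0 then st else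
  cantor_pair (s (unpair1 st) (unpair1 (unpair2 st).-1) xs) (unpair2 (unpair2 st).-1).
apply: (computable_ext (F := fun xs => unpair1
   (prec (cantor_pair (A xs) (C xs)) (fun _ st => next st xs) (C xs)))).
  move=> xs _; suff H fuel acc c : unpair1 (prec (cantor_pair acc c) (fun _ st => next st xs) fuel)
      = foldl (fun acc x => s acc x xs) acc (decode_fuel fuel c) by exact: H.
  have precSr (b : nat) j : prec b (fun _ st => next st xs) j.+1 =
      prec (next b xs) (fun _ st => next st xs) j.
    by elim: j => //= j ->.
  elim: fuel acc c => [|fuel IH] acc c; first by rewrite /= pairK1.
  rewrite precSr /next pairK1 pairK2 /=; case: eqP => [->|_] /=; last exact: IH.
  rewrite IH; by case: fuel {IH}.
apply: (comp1 computable_unpair1); apply: (computable_prec (s := fun _ st xs => next st xs)) => //.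
  by apply: (comp2 computable_pair).
rewrite /next; apply: (computable_if (b := fun ys => unpair2 (nth 0 ys 1) == 0)); comput.
  by apply: (comp2 computable_eq); comput; apply: (comp1 computable_unpair2); comput.
apply: (comp2 computable_pair); last first.
  by do ![apply: (comp1 computable_unpair2)|apply: (comp1 computable_pred)|comput].
pose Gs := (fun ys => unpair1 (nth 0 ys 1)) :: (fun ys => unpair1 (unpair2 (nth 0 ys 1)).-1)
  :: [seq (fun ys => nth 0 ys i.+2) | i <- iota 0 k].
apply: (computable_ext (F := fun ys => (fun zs => s (nth 0 zs 0) (nth 0 zs 1) (drop 2 zs))
   (map (fun G => G ys) Gs))).
  move=> [//|x [//|y ys]] [sys]; rewrite /= -map_comp drop0; congr (s _ _ _).
  by rewrite drop0 -[RHS](mkseq_nth 0) sys.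
have sGs : size Gs = k.+2 by rewrite /= size_map size_iota.
apply: (computable_comp (F := fun zs => s (nth 0 zs 0) (nth 0 zs 1) (drop 2 zs)) (Gs := Gs)).
  by rewrite sGs; exists r.
rewrite sGs => -[|[|i]] ik /=.
- by apply: (comp1 computable_unpair1); comput.
- by do ![apply: (comp1 computable_unpair1)|apply: (comp1 computable_unpair2)
         |apply: (comp1 computable_pred)|comput].
- by rewrite (nth_map 0) ?size_iota // nth_iota //; exact: computable_nth.
Qed.

Lemma computable_rev : computable1 (fun c => seq_code (rev (decode c))).
Proof.
apply: (computable_ext (F := fun xs =>
    foldl (fun acc x => cons_code x acc) 0 (decode (nth 0 xs 0)))).
  by move=> xs _; rewrite -{1}(revK (decode _)) foldl_rev.
apply: (computable_foldl (s := fun acc x _ => cons_code x acc)); comput.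
by apply: (comp2 computable_pair); comput.
Qed.

(** * Group presentations *)

Lemma inv_letterK (A : Type) : involutive (@inv_letter A).
Proof. by case=> a b; rewrite /inv_letter /= negbK. Qed.

Lemma inv_word_cat (A : Type) (u v : seq (A * bool)) :
  inv_word (u ++ v) = inv_word v ++ inv_word u.
Proof. by rewrite /inv_word map_cat rev_cat. Qed.

Lemma inv_wordK (A : Type) : involutive (@inv_word A).
Proof.
move=> w; rewrite /inv_word map_rev revK -map_comp -[RHS]map_id.
by apply: eq_map => x; exact: inv_letterK.
Qed.

Lemma size_inv_word (A : Type) (w : seq (A * bool)) : size (inv_word w) = size w.
Proof. by rewrite /inv_word size_rev size_map. Qed.

Section Presentation.
Variables (A : Type) (R : seq (A * bool) -> Prop).
Local Notation "u =R v" := (pres_eq R u v) (at level 70).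

#[global] Instance pres_equivalence : Equivalence (pres_eq R).
Proof.
split; first by move=> u; exact: rst_refl.
  by move=> u v; exact: rst_sym.
by move=> u v w; exact: rst_trans.
Qed.

Lemma pres_refl u : u =R u. Proof. reflexivity. Qed.
Local Hint Resolve pres_refl : core.

Lemma pres_insert u v r : rel_or_trivial R r -> u ++ r ++ v =R u ++ v.
Proof. by move=> Rr; apply: rst_sym; apply: rst_step; constructor. Qed.

Lemma pres_catl w u v : u =R v -> w ++ u =R w ++ v.
Proof.
elim=> {u v} [_ _ [u v r Rr]|u|u v _ IH|u v v' _ IH1 _ IH2].
- by symmetry; rewrite !catA -(catA (w ++ u)); apply: pres_insert.
- reflexivity.
- by symmetry.
- by transitivity (w ++ v).
Qed.

Lemma pres_catr w u v : u =R v -> u ++ w =R v ++ w.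
Proof.
elim=> {u v} [_ _ [u v r Rr]|u|u v _ IH|u v v' _ IH1 _ IH2].
- by symmetry; rewrite -!catA; exact: pres_insert.
- reflexivity.
- by symmetry.
- by transitivity (v ++ w).
Qed.

#[global] Instance pres_cat_proper :
  Proper (pres_eq R ==> pres_eq R ==> pres_eq R) cat.
Proof.
by move=> u u' eu v v' ev; transitivity (u ++ v'); [exact: pres_catl|exact: pres_catr].
Qed.

Lemma pres_cons x u v : u =R v -> x :: u =R x :: v.
Proof. exact: (@pres_catl [:: x]). Qed.

Lemma pres_relator r : R r -> r =R [::].
Proof. by move=> Rr; have := @pres_insert [::] [::] r (or_introl Rr); rewrite cats0. Qed.

Lemma pres_letter_invr x v : x :: inv_letter x :: v =R v.
Proof.
by apply: (@pres_insert [::] v [:: x; inv_letter x]); right; exists x.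
Qed.

Lemma pres_letter_invl x v : inv_letter x :: x :: v =R v.
Proof. by have := pres_letter_invr (inv_letter x) v; rewrite inv_letterK. Qed.

Lemma pres_invr w : w ++ inv_word w =R [::].
Proof.
elim: w => [|x w IH] //.
rewrite -[x :: w]cat1s inv_word_cat -catA (catA w) IH cat0s.
exact: (pres_letter_invr x [::]).
Qed.

Lemma pres_invl w : inv_word w ++ w =R [::].
Proof. by have := pres_invr (inv_word w); rewrite inv_wordK. Qed.

Lemma pres_cancelr w u v : u ++ w =R v ++ w -> u =R v.
Proof.
move=> euv; rewrite -[u]cats0 -[v]cats0.
by rewrite -(pres_invr w) !catA euv.
Qed.

Lemma pres_inv u v : u =R v -> inv_word u =R inv_word v.
Proof.
move=> euv; rewrite -[inv_word u]cats0 -(pres_invr v).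
by rewrite -{1}euv catA pres_invl.
Qed.

(** A presented group acts up to [E] once relators and pairs of inverse letters act trivially. [V]
    singles out the states on which they do, such as reduced words. *)
Lemma pres_act (T : Type) (V : T -> Prop) (E : T -> T -> Prop)
    (act : A * bool -> T -> T) :
  Equivalence E ->
  (forall x s, V s -> V (act x s)) ->
  (forall x s s', V s -> E s s' -> E (act x s) (act x s')) ->
  (forall r s, R r -> V s -> E (foldr act s r) s) ->
  (forall x s, V s -> E (act x (act (inv_letter x) s)) s) ->
  forall u v s, u =R v -> V s -> E (foldr act s u) (foldr act s v).
Proof.
move=> eqE actV actE actR actK u v s euv Vs.
have foldV w s' : V s' -> V (foldr act s' w) by elim: w => //= x w IH /IH; exact: actV.
elim: euv => {u v} [_ _ [u v r Rr]|u|u v _ IH|u v w _ IH1 _ IH2].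
- rewrite !foldr_cat; elim: u => [|x u IH] /=.
    symmetry; case: Rr => [Rr|[x ->]] /=; first exact: actR (foldV v s Vs).
    exact: actK (foldV v s Vs).
  by apply: actE => //; exact/(foldV _ _)/(foldV _ _).
- reflexivity.
- by symmetry.
- by transitivity (foldr act s v).
Qed.

End Presentation.

#[local] Hint Resolve pres_refl : core.

(** The universal property of a presentation. *)
Lemma pres_morph (A B : Type) (R : seq (A * bool) -> Prop) (S : seq (B * bool) -> Prop)
    (f : A * bool -> seq (B * bool)) :
  (forall x, pres_eq S (f (inv_letter x)) (inv_word (f x))) ->
  (forall r, R r -> pres_eq S (flatten (map f r)) [::]) ->
  forall u v, pres_eq R u v -> pres_eq S (flatten (map f u)) (flatten (map f v)).
Proof.
move=> finv frel u v.
elim=> {u v} [_ _ [u v r Rr]|u|u v _ IH|u v w _ IH1 _ IH2].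
- rewrite !map_cat !flatten_cat.
  suff -> : pres_eq S (flatten (map f r)) [::] by exact: pres_refl.
  case: Rr => [/frel //|[x ->]] /=; rewrite cats0 finv; exact: pres_invr.
- exact: pres_refl.
- by symmetry.
- by transitivity (flatten (map f v)).
Qed.

(** * Normal forms in right-angled Artin groups *)

Section Raag.
Variables (n : nat) (e : rel 'I_n).
Hypotheses (e_irr : irreflexive e) (e_sym : symmetric e).
Local Notation L := ('I_n * bool)%type.
Implicit Types (x y z : L) (l u v w : seq L).
Local Notation "u =A v" := (pres_eq (raag_rels e) u v) (at level 70).

Definition comm x y := e x.1 y.1.

Lemma commC x y : comm x y = comm y x. Proof. exact: e_sym. Qed.
Lemma commVl x y : comm (inv_letter x) y = comm x y. Proof. by []. Qed.

Lemma comm_neq x y : comm x y -> (x == y) = false.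
Proof. by move=> cxy; apply/eqP => exy; rewrite exy /comm e_irr in cxy. Qed.

Lemma raag_comm x y : comm x y -> [:: x; y] =A [:: y; x].
Proof.
have swap s s' : e s s' -> [:: (s, false); (s', false)] =A [:: (s', false); (s, false)].
  move=> ess'; apply: (@pres_cancelr _ _ [:: (s, true); (s', true)]) => /=.
  rewrite (pres_relator (r := [:: (s, false); (s', false); (s, true); (s', true)])).
    symmetry; transitivity [:: (s', false); (s', true)].
      exact: (pres_cons (s', false) (pres_letter_invr _ (s, false) [:: (s', true)])).
    exact: (pres_letter_invr _ (s', false) [::]).
  by exists s, s'.
(* Commuting with a letter implies commuting with its inverse, so one relator covers all four sign
   patterns. *)
have flip (p q : L) : [:: p; q] =A [:: q; p] ->
    [:: inv_letter p; q] =A [:: q; inv_letter p].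
  move=> epq; apply: (@pres_cancelr _ _ [:: p]) => /=.
  transitivity [:: q]; last by symmetry; exact: (pres_cons q (pres_letter_invl _ p [::])).
  by rewrite -(pres_cons (inv_letter p) epq); exact: pres_letter_invl.
case: x y => [s b] [s' b'] ess'; rewrite /comm /= in ess'.
have := swap _ _ ess'; case: b => [|]; case: b' => [|] // H.
- have := flip _ _ H; rewrite /inv_letter /= => H1.
  have := flip _ _ (symmetry H1); rewrite /inv_letter /= => H2; symmetry; exact: H2.
- exact: flip _ _ H.
- symmetry; exact: flip _ _ (symmetry H).
Qed.

(** * Trace equivalence: words up to commutation of letters *)

Inductive teq : seq L -> seq L -> Prop :=
| teq_nil : teq [::] [::]
| teq_skip x l l' : teq l l' -> teq (x :: l) (x :: l')
| teq_swap x y l : comm x y -> teq (x :: y :: l) (y :: x :: l)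
| teq_trans l1 l2 l3 : teq l1 l2 -> teq l2 l3 -> teq l1 l3.

#[local] Instance teq_equivalence : Equivalence teq.
Proof.
split; first by elim=> [|x l IH]; constructor.
  move=> l l'; elim=> {l l'} [|x l l' _ IH|x y l cxy|l1 l2 l3 _ IH1 _ IH2].
  - exact: teq_nil.
  - exact: teq_skip.
  - by apply: teq_swap; rewrite commC.
  - exact: teq_trans IH2 IH1.
exact: teq_trans.
Qed.

Lemma teq_refl l : teq l l. Proof. reflexivity. Qed.
Local Hint Resolve teq_refl : core.

Lemma teq_catl w u v : teq u v -> teq (w ++ u) (w ++ v).
Proof. by move=> euv; elim: w => //= x w IH; exact: teq_skip. Qed.

Lemma teq_catr w u v : teq u v -> teq (u ++ w) (v ++ w).
Proof.
elim=> {u v} //= [x l l' _ IH|x y l cxy|l1 l2 l3 _ IH1 _ IH2].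
- exact: teq_skip.
- exact: teq_swap.
- exact: teq_trans IH1 IH2.
Qed.

Lemma teq_rev u v : teq u v -> teq (rev u) (rev v).
Proof.
elim=> {u v} //= [x l l' _ IH|x y l cxy|l1 l2 l3 _ IH1 _ IH2].
- by rewrite !rev_cons -!cats1; exact: teq_catr.
- rewrite !rev_cons -!cats1 -!catA; apply: teq_catl; apply: teq_swap.
  by rewrite commC.
- exact: teq_trans IH1 IH2.
Qed.

Lemma teq_perm u v : teq u v -> perm_eq u v.
Proof.
elim=> {u v} //= [x l l' _ IH|x y l cxy|l1 l2 l3 _ IH1 _ IH2].
- by rewrite perm_cons.
- by rewrite -(cat1s x) -(cat1s y) -(cat1s y (x :: l)) -(cat1s x l) perm_catCA.
- exact: perm_trans IH1 IH2.
Qed.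

Lemma teq_size u v : teq u v -> size u = size v.
Proof. by move/teq_perm/perm_size. Qed.

Lemma teq_raag u v : teq u v -> u =A v.
Proof.
elim=> {u v} [|x l l' _ IH|x y l cxy|l1 l2 l3 _ IH1 _ IH2].
- reflexivity.
- exact: pres_cons.
- exact: (pres_catr l (raag_comm cxy)).
- by transitivity l2.
Qed.

Lemma teq_move x l : all (comm x) l -> teq (x :: l) (l ++ [:: x]).
Proof.
elim: l => //= y l IH /andP[cxy /IH {}IH].
by transitivity (y :: x :: l); [exact: teq_swap|exact: teq_skip].
Qed.

(* [del x l] removes an occurrence of [x] that can be shuffled to the front. *)
Fixpoint del x l : option (seq L) :=
  if l is y :: l' then
    if x == y then Some l'
    else if comm x y then omap (cons y) (del x l') else None
  else None.

Definition ins x l := if del (inv_letter x) l is Some l' then l' else x :: l.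

Fixpoint reduced l : bool :=
  if l is x :: l' then ~~ isSome (del (inv_letter x) l') && reduced l' else true.

Lemma del_teq_cons x l l' : del x l = Some l' -> teq l (x :: l').
Proof.
elim: l l' => [|y l IH] //= l'.
case: eqP => [-> [->] //|_]; case: ifP => // cxy.
case E: (del x l) => [l1|] //= [<-].
transitivity (y :: x :: l1); first by apply: teq_skip; apply: IH.
by apply: teq_swap; rewrite commC.
Qed.

Definition teq_opt (o o' : option (seq L)) : Prop :=
  match o, o' with
  | Some l, Some l' => teq l l'
  | None, None => True
  | _, _ => False
  end.

(** Commuting letters are distinct as [e] is irreflexive, so at most one of two swapped letters
    equals [x]. *)
Lemma del_teq x l l' : teq l l' -> teq_opt (del x l) (del x l').
Proof.
elim=> {l l'} //= [y l l' E|y z l cyz|l1 l2 l3 _ + _].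
- case: eqP => // _; case: (comm x y) => //.
  by case: (del x l) => [?|]; case: (del x l') => [?|] //=; exact: teq_skip.
- have nyz := comm_neq cyz.
  case: (eqVneq x y) => [->|nxy]; first by rewrite nyz cyz /=.
  case: (eqVneq x z) => [->|nxz]; first by rewrite commC cyz /=.
  case: (comm x y); case: (comm x z) => //=; case: (del x l) => //= l'.
  exact: teq_swap.
- case: (del x l1) => [?|]; case: (del x l2) => [?|]; case: (del x l3) => [?|] //=.
  exact: teq_trans.
Qed.

Lemma del_cons x l : del x (x :: l) = Some l.
Proof. by rewrite /= eqxx. Qed.

Lemma teq_cons_inj x l l' : teq (x :: l) (x :: l') -> teq l l'.
Proof. by move/(del_teq x); rewrite !del_cons. Qed.

Lemma isSome_del x l l' : teq l l' -> isSome (del x l) = isSome (del x l').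
Proof. by move/(del_teq x); case: (del x l); case: (del x l'). Qed.

Lemma del_comm x y l : comm x y -> del x (y :: l) = omap (cons y) (del x l).
Proof. by move=> cxy; rewrite /= (comm_neq cxy) cxy. Qed.

Lemma isSome_omap (T T' : Type) (f : T -> T') o : isSome (omap f o) = isSome o.
Proof. by case: o. Qed.

Lemma reduced_teq l l' : teq l l' -> reduced l = reduced l'.
Proof.
elim=> {l l'} //= [x l l' E ->|x y l cxy|l1 l2 l3 _ -> _ ->] //.
- by rewrite (isSome_del _ E).
- rewrite -/(del (inv_letter x) (y :: l)) -/(del (inv_letter y) (x :: l)).
  rewrite !del_comm ?commVl ?(commC y) // !isSome_omap.
  by case: (isSome _); case: (isSome _).
Qed.

Lemma reduced_behead x l : reduced (x :: l) -> reduced l.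
Proof. by case/andP. Qed.

Lemma reduced_suffix u v : reduced (u ++ v) -> reduced v.
Proof. by elim: u => //= x u IH /andP[_]. Qed.

Lemma reduced_ins x l : reduced l -> reduced (ins x l).
Proof.
rewrite /ins; case E: (del _ l) => [l'|] /= redl; last by rewrite E redl.
by move: redl; rewrite (reduced_teq (del_teq_cons E)); exact: reduced_behead.
Qed.

Lemma ins_teq x l l' : teq l l' -> teq (ins x l) (ins x l').
Proof.
move=> E; have := del_teq (inv_letter x) E; rewrite /ins.
by case: (del _ l) => [?|]; case: (del _ l') => [?|] //= _; exact: teq_skip.
Qed.

Lemma raag_ins x l : ins x l =A x :: l.
Proof.
rewrite /ins; case E: (del _ l) => [l'|]; last reflexivity.
rewrite (pres_cons x (teq_raag (del_teq_cons E))).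
by symmetry; exact: pres_letter_invr.
Qed.

(** If [inv_letter x] cancels against an [x] of [l], reducedness leaves no reachable inverse of [x]
    in the remainder, so [ins x] puts the letter back. *)
Lemma insK x l : reduced l -> teq (ins x (ins (inv_letter x) l)) l.
Proof.
rewrite {2}/ins inv_letterK; case E: (del x l) => [l'|] redl; last first.
  by rewrite /ins /= eqxx.
have El := del_teq_cons E; move: redl; rewrite (reduced_teq El) => /= /andP[nd _].
by rewrite /ins; case: (del _ l') nd => // _; symmetry.
Qed.

(** Removing a reachable inverse of [x] does not change whether an inverse of [y] can be reached,
    because the two letters commute. *)
Lemma ins_comm x y l : comm x y -> teq (ins x (ins y l)) (ins y (ins x l)).
Proof.
move=> cxy; have cyx : comm y x by rewrite commC.
have nil_y l1 : del (inv_letter x) l = Some l1 ->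
    isSome (del (inv_letter y) l) = isSome (del (inv_letter y) l1).
  by move/del_teq_cons/(isSome_del (inv_letter y))=> ->; rewrite del_comm ?isSome_omap.
have nil_x l1 : del (inv_letter y) l = Some l1 ->
    isSome (del (inv_letter x) l) = isSome (del (inv_letter x) l1).
  by move/del_teq_cons/(isSome_del (inv_letter x))=> ->; rewrite del_comm ?isSome_omap.
rewrite /ins.
case Ex: (del (inv_letter x) l) => [lx|]; case Ey: (del (inv_letter y) l) => [ly|] /=.
- case Eyx: (del (inv_letter y) lx) => [lyx|]; last by move: (nil_y _ Ex); rewrite Ey Eyx.
  case Exy: (del (inv_letter x) ly) => [lxy|]; last by move: (nil_x _ Ey); rewrite Ex Exy.
  apply: (@teq_cons_inj (inv_letter y)); apply: (@teq_cons_inj (inv_letter x)).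
  have E1 := teq_skip (inv_letter x) (del_teq_cons Eyx).
  have E2 := teq_skip (inv_letter y) (del_teq_cons Exy).
  rewrite -E1 -(del_teq_cons Ex) (del_teq_cons Ey) E2; exact: teq_swap.
- rewrite -/(del (inv_letter x) (y :: l)) del_comm // Ex /=.
  by have := nil_y _ Ex; rewrite Ey; case: (del _ lx).
- rewrite -/(del (inv_letter y) (x :: l)) del_comm // Ey /=.
  by have := nil_x _ Ey; rewrite Ex; case: (del _ ly).
- rewrite -/(del (inv_letter x) (y :: l)) del_comm // Ex /=.
  rewrite -/(del (inv_letter y) (x :: l)) del_comm // Ey /=.
  exact: teq_swap.
Qed.

(** * The action on reduced words and uniqueness of normal forms *)

Lemma raag_foldr_ins u v l :
  u =A v -> reduced l -> teq (foldr ins l u) (foldr ins l v).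
Proof.
apply: (pres_act (V := fun l => reduced l)) => {u v l} [x l|x l l' _|r l|x l].
- exact: reduced_ins.
- exact: ins_teq.
- move=> [s [s' [ess' ->]]] redl /=.
  have red1 := reduced_ins (s', true) redl; have red2 := reduced_ins (s, true) red1.
  transitivity (ins (s', false) (ins (s, false) (ins (s, true) (ins (s', true) l)))).
    exact: ins_comm.
  rewrite (ins_teq (s', false) (insK (s, false) red1)).
  exact: (insK (s', false)).
- exact: insK.
Qed.

Definition nf w := foldr ins [::] w.

Lemma reduced_nf w : reduced (nf w).
Proof. by elim: w => //= x w; exact: reduced_ins. Qed.

Lemma raag_nf w : nf w =A w.
Proof. by elim: w => //= x w IH; rewrite raag_ins; exact: pres_cons. Qed.

Lemma nf_reduced w : reduced w -> nf w = w.
Proof.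
elim: w => //= x w IH /andP[nd /IH ->].
by rewrite /ins; case: (del _ w) nd.
Qed.

Lemma size_nf w : size (nf w) <= size w.
Proof.
elim: w => //= x w IH; rewrite /ins.
by case E: (del _ _) => [l|] //=; have := teq_size (del_teq_cons E) => /=; lia.
Qed.

Lemma teq_nf u v : u =A v -> teq (nf u) (nf v).
Proof. by move/raag_foldr_ins; apply. Qed.

(** A reduced word is recovered by letting it act on the empty word, and the action depends only on
    the group element. *)
Lemma reduced_uniq u v : reduced u -> reduced v -> u =A v -> teq u v.
Proof. by move=> /nf_reduced {2}<- /nf_reduced {2}<-; exact: teq_nf. Qed.

Lemma raag_letter_inj x y : [:: x] =A [:: y] -> x = y.
Proof.
move/reduced_uniq => /(_ isT isT) /teq_perm/perm_mem/(_ x).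
by rewrite !inE eqxx => /esym/eqP.
Qed.

(** A characterization stable under reversal, which carries results on left multiplication over to
    right multiplication. *)
Lemma reducedP l :
  reduced l <-> forall a y b, ~ teq l (a ++ y :: inv_letter y :: b).
Proof.
split=> [redl a y b E|].
  move: redl; rewrite (reduced_teq E) => /reduced_suffix /=.
  by rewrite eqxx.
elim: l => //= x l IH H; case E: (del _ l) => [l'|] /=.
  by case: (H [::] x l'); apply: teq_skip; exact: del_teq_cons.
apply: IH => a y b E'; apply: (H (x :: a) y b); exact: teq_skip.
Qed.

Lemma reduced_rev l : reduced (rev l) = reduced l.
Proof.
suff imp k : reduced k -> reduced (rev k).
  by apply/idP/idP => /imp //; rewrite revK.
move=> /reducedP H; apply/reducedP => a y b /teq_rev; rewrite revK.
rewrite rev_cat !rev_cons -!cats1 -!catA /= -{2}[y]inv_letterK; exact: H.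
Qed.

Lemma reduced_rcons l x : reduced l ->
  reduced (l ++ [:: x]) \/
  exists2 l', reduced l' & teq l (l' ++ [:: inv_letter x]).
Proof.
rewrite -reduced_rev => redl; rewrite -(reduced_rev (_ ++ _)) rev_cat /= redl.
case E: (del _ _) => [l'|] /=; [right|by left].
have El := del_teq_cons E; exists (rev l').
  by rewrite reduced_rev; move: redl; rewrite (reduced_teq El) => /reduced_behead.
by rewrite -[l]revK (teq_rev El) rev_cons -cats1.
Qed.

(** * Heaps and truncations *)

Implicit Types (g h : 'I_n) (i j : nat) (P Q : L -> seq L -> bool).

(* In the heap of pieces [l], whose bottom is the right end, a piece over [g]
   dropped on top of [l] lands at height [ht l g]. *)
Fixpoint ht l g : nat :=
  if l is y :: l' then
    if e g y.1 then ht l' g else maxn (ht l' y.1).+1 (ht l' g)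
  else 0.

(** The predicate sees a letter together with the original word to its right, that is, the heap onto
    which the letter is dropped. *)
Fixpoint filt (P : L -> seq L -> bool) l : seq L :=
  if l is y :: l' then if P y l' then y :: filt P l' else filt P l' else [::].

(** [sfx i] keeps the [i] lowest layers of the Foata normal form, heights being counted from 0;
    [cosfx i] keeps the layers above. *)
Definition sfx i l := filt (fun y l' => ht l' y.1 < i) l.
Definition cosfx i l := filt (fun y l' => i <= ht l' y.1) l.

Lemma filt_ext P Q l : (forall y l', P y l' = Q y l') -> filt P l = filt Q l.
Proof. by move=> E; elim: l => //= y l ->; rewrite E. Qed.

Lemma filt_false P l : (forall y l', P y l' = false) -> filt P l = [::].
Proof. by move=> E; elim: l => //= y l ->; rewrite E. Qed.

(** Each letter satisfying [Q] commutes with the [P]-letters to its right, so it can be moved past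
    them. *)
Lemma filt_split P Q l :
  (forall y l', P y l' -> Q y l' -> false) ->
  (forall y l', Q y l' -> {in filt P l', forall z, comm y z}) ->
  teq (filt (fun y l' => P y l' || Q y l') l) (filt P l ++ filt Q l).
Proof.
move=> dPQ cPQ; elim: l => [|y l IH] /=; first reflexivity.
case Py: (P y l); case Qy: (Q y l) => //=.
- by have := dPQ y l Py Qy.
- exact: teq_skip.
- transitivity (y :: filt P l ++ filt Q l); first exact: teq_skip.
  rewrite -[y :: filt Q l]cat1s catA -cat_cons; apply: teq_catr.
  by apply: teq_move; apply/allP; exact: cPQ.
Qed.

(** A piece that does not commute with [g] forces [g] to land above it. The word [r] beneath the
    heap covers heights after a letter is appended. *)
Lemma ht_filt (P : L -> seq L -> bool) r j l g z :
  (forall y l', P y l' -> j <= ht (l' ++ r) y.1) ->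
  z \in filt P l -> ~~ e g z.1 -> j < ht (l ++ r) g.
Proof.
move=> HP; elim: l => //= y l IH; case Py: (P y l) => [|]; last first.
  by move=> /IH{}IH /IH; case: (e g y.1) => //; lia.
rewrite inE => /predU1P[->|/IH{}IH].
  by move=> /negbTE ->; have := HP _ _ Py; lia.
by move=> /IH; case: (e g y.1) => //; lia.
Qed.

Lemma ht_teq l l' : teq l l' -> ht l =1 ht l'.
Proof.
elim=> {l l'} //= [x l l' _ IH g|x y l cxy g|l1 l2 l3 _ IH1 _ IH2 g].
- by rewrite !IH.
- have := cxy; rewrite /comm (e_sym y.1) => ->.
  by case: (e g x.1); case: (e g y.1) => //; rewrite maxnCA.
- by rewrite IH1.
Qed.

Lemma sfx_cons i x l : sfx i (x :: l) = if ht l x.1 < i then x :: sfx i l else sfx i l.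
Proof. by []. Qed.

Lemma sfx_teq i l l' : teq l l' -> teq (sfx i l) (sfx i l').
Proof.
elim=> {l l'} [|x l l' E IH|x y l cxy|l1 l2 l3 _ IH1 _ IH2].
- reflexivity.
- by rewrite !sfx_cons (ht_teq E); case: ifP => // _; exact: teq_skip.
- rewrite !sfx_cons /=; have := cxy; rewrite /comm (e_sym y.1) => ->.
  case: (ht l x.1 < i); case: (ht l y.1 < i); try reflexivity.
  exact: teq_swap.
- exact: teq_trans IH1 IH2.
Qed.

Lemma sfx0 l : sfx 0 l = [::].
Proof. by apply: filt_false => y l'; rewrite ltn0. Qed.

(** A low letter commutes with the high letters to its right, since it would land above any that it
    does not commute with. *)
Lemma sfx_cosfx i l : teq l (cosfx i l ++ sfx i l).
Proof.
transitivity (filt (fun y l' => (i <= ht l' y.1) || (ht l' y.1 < i)) l).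
  rewrite (_ : filt _ l = l); first reflexivity.
  by elim: l => //= y l ->; rewrite leqNgt orNb.
apply: filt_split => [y l'|y l' Hy z Hz]; first lia.
apply: contraTT Hy; rewrite -leqNgt => nyz; apply: ltnW.
by rewrite -[l']cats0; apply: ht_filt Hz nyz => y' l''; rewrite cats0.
Qed.

(** Pieces over the same vertex do not commute and so lie at different heights; a layer has at most
    one piece per vertex. *)
Lemma filt_layer_size P j l :
  (forall y l', P y l' -> ht l' y.1 = j) -> size (filt P l) <= n.
Proof.
move=> HP; rewrite -(size_map fst) -[leqRHS]card_ord.
suff /card_uniqP <- : uniq (map fst (filt P l)) by exact: max_card.
elim: l => //= y l IH; case Py: (P y l) => //=; rewrite IH andbT.
apply/mapP => -[z Hz eyz]; have := HP _ _ Py.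
suff : j < ht (l ++ [::]) y.1 by rewrite cats0; lia.
apply: ht_filt Hz _; last by rewrite -eyz e_irr.
by move=> y' l' /HP; rewrite cats0 => ->.
Qed.

Lemma ht_rcons l x g : ht l g <= ht (l ++ [:: x]) g <= (ht l g).+1.
Proof.
elim: l g => [|y l IH] g /=; first by case: (e _ _).
by move: (IH g) (IH y.1); case: (e g y.1) => //; lia.
Qed.

(* Appending [x] below the heap raises every piece by 0 or 1, so only pieces of
   height exactly [i - 1] can leave the bottom part of height [i]. *)
Lemma sfx_rcons i l x :
  exists2 D, size D <= n.+1 & teq (sfx i l ++ [:: x]) (D ++ sfx i (l ++ [:: x])).
Proof.
case: i => [|i].
  by exists [:: x] => //; rewrite !sfx0; reflexivity.
(* [P] selects the pieces pushed out of the bottom part by the new letter, [Q] those that stay. *)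
set P := fun y l' => (ht l' y.1 < i.+1) && (i.+1 <= ht (l' ++ [:: x]) y.1).
set Q := fun y l' => ht (l' ++ [:: x]) y.1 < i.+1.
exists (filt P l).
  apply: leqW; apply: (@filt_layer_size P i) => y l' /andP[].
  by have := ht_rcons l' x y.1; lia.
have -> : sfx i.+1 (l ++ [:: x]) = filt Q l ++ [:: x].
  by elim: l => [|y l IH] //=; rewrite sfx_cons IH /Q; case: ifP.
rewrite catA; apply: teq_catr.
rewrite {1}/sfx (_ : filt _ l = filt (fun y l' => P y l' || Q y l') l); last first.
  by apply: filt_ext => y l'; rewrite /P /Q; have := ht_rcons l' x y.1; lia.
apply: filt_split => [y l'|y l' Hy z Hz]; rewrite /P /Q; first lia.
apply: contraTT Hy => nyz; rewrite /Q -leqNgt; apply: ltnW.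
by apply: ht_filt Hz nyz => y' l'' /andP[].
Qed.

Lemma size_sfx_leq i l : size (sfx i l) <= size (sfx i.+1 l).
Proof. by elim: l => //= y l; rewrite !sfx_cons; do 2 case: ifP => /=; lia. Qed.

Lemma size_filt P l : size (filt P l) <= size l.
Proof. by elim: l => //= y l; case: ifP => /=; lia. Qed.

Lemma size_sfx i l : size (sfx i l) <= n * i.
Proof.
elim: i => [|i IH]; first by rewrite sfx0 muln0.
rewrite mulnS; apply: leq_trans (leq_add (leqnn n) IH).
set P := fun y l' => ht l' y.1 == i.
have szP : size (filt P l) <= n by apply: (@filt_layer_size P i) => y l' /eqP.
suff E : size (sfx i.+1 l) = size (filt P l) + size (sfx i l) by rewrite E leq_add2r.
elim: l {szP IH} => //= y l IHl; rewrite !sfx_cons (_ : P y l = (ht l y.1 == i)) //.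
by rewrite ltnS; case: (ltngtP (ht l y.1) i) => H /=; rewrite IHl ?addnS.
Qed.

Lemma sfx_full_ht i l g : sfx i l = l -> ht l g <= i.
Proof.
elim: l => //= x l IH; rewrite sfx_cons; case: ifP => [hx [/IH{}IH]|_ E].
  by case: (e g x.1); lia.
by have := size_filt (fun y l' => ht l' y.1 < i) l; rewrite -/(sfx i l) E /= ltnn.
Qed.

(** Layers are occupied without gaps: if layer [i] adds no piece, nothing lies above it. *)
Lemma sfx_full i l : size (sfx i.+1 l) <= size (sfx i l) -> sfx i l = l.
Proof.
elim: l => //= x l IH; rewrite !sfx_cons; have := size_sfx_leq i l.
case: (ltnP (ht l x.1) i) => [hx|hx].
  by rewrite ltnS (ltnW hx) /= => _; rewrite ltnS => /IH ->.
case: ifP => [_ /=|hx' /= _ /IH E]; first lia.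
by have := sfx_full_ht x.1 E; lia.
Qed.

Lemma sfx_size_id l : sfx (size l) l = l.
Proof.
have full i : size l <= size (sfx i l) -> sfx i l = l.
  by move=> H; apply: sfx_full; apply: leq_trans H; exact: size_filt.
have H i : sfx i l = l \/ i <= size (sfx i l).
  elim: i => [|i [IH|IH]]; first by right.
    by left; apply: full; move: (size_sfx_leq i l); rewrite IH.
  case: (leqP (size (sfx i.+1 l)) (size (sfx i l))) => [/sfx_full E|H].
    by left; apply: full; move: (size_sfx_leq i l); rewrite E.
  by right; exact: leq_trans H.
by case: (H (size l)) => // /full.
Qed.

(** A letter inserted or cancelled at the top alters no other height, so the truncation changes by
    that letter or not at all. *)
Lemma sfx_left l w i : exists2 E, size E <= size w &
  sfx i (foldr ins l w) =A E ++ sfx i l.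
Proof.
elim: w => [|x w [E sE IH]] /=; first by exists [::] => //; reflexivity.
have one l1 : exists2 D, size D <= 1 & sfx i (ins x l1) =A D ++ sfx i l1.
  rewrite /ins; case Ed: (del _ _) => [l2|]; last first.
    rewrite sfx_cons; case: ifP => _.
      by exists [:: x] => //; reflexivity.
    by exists [::] => //; reflexivity.
  have := teq_raag (sfx_teq i (del_teq_cons Ed)); rewrite sfx_cons.
  case: ifP => _ H.
    exists [:: x] => //; rewrite H; symmetry; exact: pres_letter_invr.
  by exists [::] => //; symmetry.
have [D sD ED] := one (foldr ins l w).
exists (D ++ E); first by rewrite size_cat; lia.
by rewrite ED -catA; apply: pres_catl.
Qed.

(** One reduced form [l'] of the product serves all heights [i]. Each letter of [u] costs at most
    [n.+1] letters of error by [sfx_rcons]. *)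
Lemma sfx_right l u : reduced l -> exists l',
  [/\ reduced l', l' =A l ++ u &
   forall i, exists2 E, size E <= n.+1 * size u & sfx i l ++ u =A E ++ sfx i l'].
Proof.
elim/last_ind: u => [|u x IH] redl.
  exists l; split=> // [|i]; first by rewrite cats0; reflexivity.
  by exists [::]; rewrite ?muln0 // cats0; reflexivity.
have [l1 [red1 eq1 H1]] := IH redl; rewrite -cats1.
have [red2|[l2 red2 eq2]] := reduced_rcons x red1.
  exists (l1 ++ [:: x]); split=> // [|i]; first by rewrite catA; exact: pres_catr.
  have [E sE EE] := H1 i; have [D sD ED] := sfx_rcons i l1 x.
  exists (E ++ D); first by rewrite !size_cat mulnDr /=; lia.
  rewrite catA (pres_catr _ EE) -!catA; apply: pres_catl; exact: teq_raag ED.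
(* In the cancelling case [l1] is [l2] followed by the inverse of [x], so [sfx_rcons] is applied to
   [l2] and its error term inverted. *)
have eq2x : l2 =A l1 ++ [:: x].
  rewrite (pres_catr _ (teq_raag eq2)) -catA /=.
  by symmetry; rewrite -[X in _ =A X]cats0; apply: pres_catl; exact: pres_letter_invl.
exists l2; split=> // [|i].
  by rewrite eq2x catA; exact: pres_catr.
have [E sE EE] := H1 i; have [D sD ED] := sfx_rcons i l2 (inv_letter x).
exists (E ++ inv_word D).
  by rewrite !size_cat size_inv_word mulnDr /=; lia.
rewrite catA (pres_catr _ EE) -!catA; apply: pres_catl.
have {}ED : D ++ sfx i l1 =A sfx i l2 ++ [:: inv_letter x].
  rewrite (teq_raag ED); apply: pres_catl; apply: teq_raag; exact: sfx_teq.
transitivity (inv_word D ++ D ++ sfx i l1 ++ [:: x]).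
  by rewrite (catA (inv_word D)) (pres_catr _ (pres_invl _ D)).
apply: pres_catl.
rewrite catA ED -catA -[X in _ =A X]cats0; apply: pres_catl; exact: pres_letter_invl.
Qed.

(** * Twisted equations and cutting out slices *)

Section Twisted.
Variable f : L -> L.
Hypotheses (f_inj : injective f) (f_inv : forall x, f (inv_letter x) = inv_letter (f x)).
Hypothesis f_comm : forall x y, comm (f x) (f y) = comm x y.

Lemma ht_map l x : ht (map f l) (f x).1 = ht l x.1.
Proof.
elim: l x => //= y l IH x; rewrite !IH.
by rewrite -/(comm (f x) (f y)) f_comm.
Qed.

Lemma sfx_map i l : sfx i (map f l) = map f (sfx i l).
Proof. by elim: l => //= y l IH; rewrite !sfx_cons ht_map IH; case: ifP. Qed.

Lemma del_map x l : del (f x) (map f l) = omap (map f) (del x l).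
Proof.
elim: l => //= y l IH; rewrite (inj_eq f_inj) f_comm IH.
by case: eqP => // _; case: ifP => // _; case: (del x l).
Qed.

Lemma reduced_map l : reduced (map f l) = reduced l.
Proof. by elim: l => //= x l ->; rewrite -f_inv del_map isSome_omap. Qed.

Lemma raag_map u v : u =A v -> map f u =A map f v.
Proof.
have flat w : flatten (map (fun x => [:: f x]) w) = map f w by elim: w => //= x w ->.
move=> euv; rewrite -!flat; move: u v euv; apply: pres_morph => [x|r].
  by rewrite f_inv.
move=> [s [s' [ess' ->]]] /=.
rewrite (f_inv (s, false)) (f_inv (s', false)).
have cff : comm (f (s, false)) (f (s', false)) by rewrite f_comm.
have := pres_catr [:: inv_letter (f (s, false)); inv_letter (f (s', false))]
  (raag_comm cff) => /= ->.
have := pres_letter_invr (raag_rels e) (f (s, false)) [:: inv_letter (f (s', false))].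
by move/(pres_cons (f (s', false))) => ->; exact: pres_letter_invr.
Qed.

(** Both sides have equivalent reduced forms, hence equivalent truncations. [sfx_right] compares
    these with the image of [sfx i z], and [sfx_left] with [sfx i z] itself. The bound on [E] does
    not depend on [i]. *)
Lemma sfx_twisted (z : seq L) u w : reduced z -> map f z ++ u =A w ++ z ->
  forall i, exists2 E, size E <= n.+1 * size u + size w &
    map f (sfx i z) ++ u =A E ++ sfx i z.
Proof.
move=> redz eqz i.
have [l' [redl' eql' /(_ i) [E sE EE]]] : exists l',
  [/\ reduced l', l' =A map f z ++ u & forall i, exists2 E,
     size E <= n.+1 * size u & sfx i (map f z) ++ u =A E ++ sfx i l'].
  by apply: sfx_right; rewrite reduced_map.
have [E' sE' EE'] := sfx_left z w i.
exists (E ++ E'); first by rewrite size_cat leq_add.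
rewrite -sfx_map EE -catA; apply: pres_catl; rewrite -EE'.
apply: teq_raag; apply: sfx_teq; apply: reduced_uniq => //.
  by elim: (w) => //= x w' IH; exact: reduced_ins.
rewrite eql' eqz; elim: (w) => //= x w' IH.
by rewrite raag_ins //; exact: pres_cons.
Qed.

(* If two of the error terms [E] along the bottom parts of [z] coincide, the
   slice of [z] between them can be cut out. *)
Lemma twisted_bound (c : seq L -> nat) M u w (z : seq L) :
  injective c -> (forall v, size v <= n.+1 * size u + size w -> c v <= M) ->
  map f z ++ u =A w ++ z ->
  exists2 z' : seq L, size z' <= n * M & map f z' ++ u =A w ++ z'.
Proof.
move=> c_inj cM; have [k] := ubnP (size z); elim: k z => // k IH z0 sz0 eqz0.
have [z [redz sz eqz]] : exists z : seq L,
    [/\ reduced z, size z <= size z0 & map f z ++ u =A w ++ z].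
  exists (nf z0); split; [exact: reduced_nf|exact: size_nf|].
  have E := raag_nf z0.
  by rewrite (pres_catl _ E) (pres_catr _ (raag_map E)).
case: (leqP (size z) (n * M)) => [szM|szM]; first by exists z.
(* [N] is the number of layers of [z]. *)
have [N fullN ltN] : exists2 N, sfx N z = z & forall i, i < N -> sfx i z <> z.
  have exN : exists i, sfx i z == z by exists (size z); rewrite sfx_size_id.
  case: (ex_minnP exN) => N /eqP fN minN; exists N => // i ltiN /eqP /minN; lia.
(* A layer has at most [n] letters, so more than [n * M] letters need more than [M] layers. *)
have MN : M < N.
  rewrite ltnNge; apply: contraL szM; rewrite -leqNgt => leNM; rewrite -fullN.
  by apply: leq_trans (size_sfx _ _) _; rewrite leq_mul2l leNM orbT.
have [E sE EE] := fin_all_exists2 (fun i : 'I_N.+1 => sfx_twisted redz eqz i).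
have cE (i : 'I_N.+1) : c (E i) < M.+1 by rewrite ltnS; exact: cM.
pose h (i : 'I_N.+1) : 'I_M.+1 := Ordinal (cE i).
(* Pigeonhole: the [N.+1] error terms have codes at most [M], and [M < N]. *)
have /injectivePn [i [j nij hij]] : ~~ injectiveb h.
  by apply/injectiveP => /leq_card; rewrite !card_ord; lia.
have Eij : E i = E j by apply: c_inj; exact: (congr1 val hij).
wlog ltij : i j nij Eij {hij} / i < j.
  move=> H; case: (ltngtP i j) => [||eij]; [exact: H| |by case/eqP: nij; exact: val_inj].
  by apply: H => //; rewrite eq_sym.
(* Since [i < N], layer [i] is nonempty, so the cut really shortens [z]. *)
have szij : size (sfx i z) < size (sfx j z).
  apply: leq_trans (leq_trans (_ : size (sfx i z) < size (sfx i.+1 z)) _) (leqnn _).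
    rewrite ltnNge; apply/negP => /sfx_full; apply: ltN.
    by have := ltn_ord j; lia.
  by elim: (nat_of_ord j) ltij => // j' IHj; rewrite ltnS leq_eqVlt => /predU1P[->|/IHj H] //;
     apply: leq_trans H (size_sfx_leq _ _).
have zj := teq_raag (sfx_cosfx j z).
(* Dividing the equation for [z] by that for its bottom part leaves one for the top part, in which
   [E j] may then be replaced by the equal [E i]. *)
have key : w ++ cosfx j z =A map f (cosfx j z) ++ E j.
  apply: (@pres_cancelr _ _ (sfx j z)); rewrite -!catA -EE (catA (map f _)) -map_cat.
  by rewrite -(pres_catl w zj) -eqz (pres_catr u (raag_map zj)).
apply: (IH (cosfx j z ++ sfx i z)).
  by move: (teq_size (sfx_cosfx j z)); rewrite !size_cat; lia.
rewrite catA (pres_catr _ key) map_cat -!catA; apply: pres_catl.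
by rewrite -Eij EE.
Qed.

End Twisted.
(** * The semidirect product *)

(** A letter has length 1, hence so has its image, which is therefore equal to a letter. The other
    properties transfer from the group because distinct letters are distinct elements. *)
Lemma aut_letters (phi : 'I_n -> seq L) m :
  is_raag_aut e phi -> length_preserving e phi -> aut_order e phi m ->
  exists f : L -> L,
    [/\ injective f, forall x, f (inv_letter x) = inv_letter (f x),
        forall x y, comm (f x) (f y) = comm x y,
        forall s, phi s =A [:: f (s, false)] & forall x, iter m f x = x].
Proof.
move=> [phiE phiI _] lp [m_gt0 phim _].
have phi_cons x w : phi_word phi (x :: w) = phi_word phi [:: x] ++ phi_word phi w.
  by rewrite /phi_word /= cats0.
have len1 x : is_word_length e [:: x] 1.
  split; first by exists [:: x]; split; first reflexivity.
  by case=> // /teq_nf/teq_size.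
have [f fE] : exists f, forall x, phi_word phi [:: x] =A [:: f x].
  apply: (@fin_all_exists _ (fun=> L) (fun x y => phi_word phi [:: x] =A [:: y])) => x.
  by case: ((lp [:: x] 1).2 (len1 x)) => -[[|y [|? ?]] []] // Ew _ _; exists y.
have phif w : phi_word phi w =A map f w.
  by elim: w => [|x w IH]; [reflexivity|rewrite phi_cons fE /=; exact: pres_cons].
have f_inj : injective f.
  move=> x y fxy; apply: raag_letter_inj; apply: phiI.
  by rewrite /raag_eq !phif /= fxy; reflexivity.
have f_inv x : f (inv_letter x) = inv_letter (f x).
  apply: raag_letter_inj; rewrite -fE.
  transitivity (inv_word (phi_word phi [:: x])); last exact: pres_inv (fE x).
  by case: x => s [] /=; rewrite /phi_word /= !cats0 ?inv_wordK; reflexivity.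
have fm w k : iter k (phi_word phi) w =A map (iter k f) w.
  elim: k => [|k IH] /=; first by rewrite map_id; reflexivity.
  rewrite (phiE _ _ IH : _ =A _) phif -map_comp; reflexivity.
have fmK x : iter m f x = x.
  apply: raag_letter_inj; transitivity (iter m (phi_word phi) [:: x]); last exact: phim.
  by symmetry; exact: fm.
have f_comm1 x y : comm x y -> comm (f x) (f y).
  move=> cxy; have := phiE _ _ (raag_comm cxy); rewrite /raag_eq !phif /= => Efxy.
  have nxy z : z.1 = y.1 -> f x == f z = false.
    by move=> ezy; rewrite (inj_eq f_inj); apply: comm_neq; rewrite /comm ezy.
  have n1 : (inv_letter (f x) == f y) = false.
    by rewrite -f_inv (inj_eq f_inj); apply: comm_neq.
  have n2 : (inv_letter (f y) == f x) = false.
    by rewrite -f_inv (inj_eq f_inj); apply: comm_neq; rewrite commVl commC.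
  apply/negPn/negP => ncomm.
  have ncomm' : ~~ comm (f y) (f x) by rewrite commC.
  (* If [f x] and [f y] did not commute, the lowest layers of the two equal products would be [f y]
     and [f x] respectively. *)
  have /teq_perm : teq (sfx 1 [:: f x; f y]) (sfx 1 [:: f y; f x]).
    apply: sfx_teq; apply: reduced_uniq => //=.
      by rewrite n1 commVl (negbTE ncomm).
    by rewrite n2 commVl (negbTE ncomm').
  rewrite /sfx /= -/(comm (f x) (f y)) -/(comm (f y) (f x)).
  rewrite (negbTE ncomm) (negbTE ncomm') /= => /perm_mem/(_ (f x)).
  by rewrite !inE eqxx (nxy y).
have f_commk k x y : comm x y -> comm (iter k f x) (iter k f y).
  by elim: k => // k IH /IH; exact: f_comm1.
exists f; split=> // [x y|s]; last first.
  by rewrite -(fE (s, false)) /phi_word /= cats0; reflexivity.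
apply/idP/idP; last exact: f_comm1.
(* Finite order gives the converse: [m.-1] further applications bring [f x] back to [x]. *)
move/(f_commk m.-1); rewrite -!iterSr prednK // !fmK //.
Qed.

(** * The action of $A_\phi$ on normal forms *)

Section Semidirect.
Variables (phi : 'I_n -> seq L) (m : nat) (f : L -> L).
Hypotheses (m_gt0 : 0 < m) (f_inj : injective f).
Hypothesis f_inv : forall x, f (inv_letter x) = inv_letter (f x).
Hypothesis f_comm : forall x y, comm (f x) (f y) = comm x y.
Hypothesis f_phi : forall s, phi s =A [:: f (s, false)].
Hypothesis f_order : forall x, iter m f x = x.
Local Notation W := (seq (option 'I_n * bool)).
Local Notation "u =G v" := (pres_eq (aphi_rels e phi m) u v) (at level 70).
Local Notation emb := (@emb_word n).
Local Notation emb1 := (fun x : L => (Some x.1, x.2)).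
Implicit Types (a b : nat) (U V Z : W) (st : nat * seq L).

Lemma iter_inj k : injective (iter k f).
Proof. by elim: k => // k IH x y /= /f_inj /IH. Qed.

Lemma iter_inv k x : iter k f (inv_letter x) = inv_letter (iter k f x).
Proof. by elim: k => //= k ->. Qed.

Lemma iter_comm k x y : comm (iter k f x) (iter k f y) = comm x y.
Proof. by elim: k => //= k <-. Qed.

Lemma iter_modm k x : iter (k %% m) f x = iter k f x.
Proof.
rewrite {2}(divn_eq k m) addnC iterD; congr (iter _ f _).
by elim: (k %/ m) => // q IH; rewrite mulSn addnC iterD f_order.
Qed.

Lemma raag_iter k u v : u =A v -> map (iter k f) u =A map (iter k f) v.
Proof. by apply: raag_map; [exact: iter_inv|exact: iter_comm]. Qed.

Lemma emb_cat u v : emb (u ++ v) = emb u ++ emb v.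
Proof. exact: map_cat. Qed.

Lemma emb_inv u : emb (inv_word u) = inv_word (emb u).
Proof. by rewrite /inv_word /emb_word map_rev -!map_comp. Qed.

Lemma emb_raag u v : u =A v -> emb u =G emb v.
Proof.
have flat w : flatten (map (fun x => [:: emb1 x]) w) = emb w by elim: w => //= x w ->.
move=> euv; rewrite -!flat; move: u v euv; apply: pres_morph => [x|r]; first by [].
move=> [s [s' [ess' ->]]] /=; apply: pres_relator; left; by exists s, s'.
Qed.

Definition tpow a : W := nseq a (None, false).

Lemma tpowD a b : tpow (a + b) = tpow a ++ tpow b.
Proof. by rewrite /tpow nseqD. Qed.

Lemma tpow_modm a : tpow (a %% m) =G tpow a.
Proof.
rewrite {2}(divn_eq a m) tpowD; elim: (_ %/ m) => [|q IH] //.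
rewrite mulSn tpowD -catA.
have -> : tpow m =G [::] by apply: pres_relator; right; left.
exact: IH.
Qed.

(** The relator for conjugation by [t], solved for the product of a letter and [t]. An inverse
    letter is handled by cancelling [f (s, false)]. *)
Lemma emb_t x : [:: emb1 x; (None, false)] =G [:: (None, false); emb1 (f x)].
Proof.
have pos s : [:: emb1 (s, false); (None, false)] =G [:: (None, false); emb1 (f (s, false))].
  have Er := @pres_relator _ (aphi_rels e phi m) _
    (or_intror (or_intror (ex_intro _ s (erefl _)))).
  have Es : [:: (None, true); (Some s, false); (None, false)] =G [:: emb1 (f (s, false))].
    rewrite -[X in _ =G X]/(emb [:: f (s, false)]) -(emb_raag (f_phi s)).
    apply: (@pres_cancelr _ _ (inv_word (emb (phi s)))).
    by rewrite [X in X =G _]Er; symmetry; exact: pres_invr.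
  rewrite -(pres_cons _ Es); symmetry; exact: (pres_letter_invr _ (None, false)).
case: x => s [] //; apply: (@pres_cancelr _ _ [:: emb1 (f (s, false))]).
rewrite (f_inv (s, false)).
transitivity [:: (None : option 'I_n, false)]; last first.
  symmetry; apply: (pres_cons _ (v := [::])).
  exact: (pres_letter_invl _ (emb1 (f (s, false))) [::]).
transitivity [:: emb1 (s, true); emb1 (s, false); (None, false)].
  by apply: (pres_cons (emb1 (s, true))); symmetry; exact: pos.
exact: (pres_letter_invl _ (emb1 (s, false)) [:: (None, false)]).
Qed.

Lemma emb_tpow u a : emb u ++ tpow a =G tpow a ++ emb (map (iter a f) u).
Proof.
have one v : emb v ++ [:: (None, false)] =G (None, false) :: emb (map f v).
  elim: v => //= x v IH; rewrite (pres_cons _ IH).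
  exact: (pres_catr (emb (map f v)) (emb_t x)).
elim: a u => [|a IH] u; first by rewrite map_id cats0.
rewrite -addn1 tpowD catA IH -!catA one addn1 -map_comp.
exact: pres_refl.
Qed.

(* Left multiplication by [x] on [t^a l], encoded as [(a, l)]: since
   [x t = t phi(x)], a letter passes [t^a] by applying [f] [a] times. *)
Definition act (x : option 'I_n * bool) st :=
  match x with
  | (None, false) => ((st.1 + 1) %% m, st.2)
  | (None, true) => ((st.1 + m.-1) %% m, st.2)
  | (Some s, b) => (st.1, ins (iter st.1 f (s, b)) st.2)
  end.

Definition repr st := tpow st.1 ++ emb st.2.
Definition valid st := (st.1 < m) && reduced st.2.
Definition st_eq st st' := st.1 = st'.1 /\ teq st.2 st'.2.

Lemma st_eq_equivalence : Equivalence st_eq.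
Proof.
split=> [st|st st' [E1 E2]|s1 s2 s3 [E1 E2] [E3 E4]].
- by split; last reflexivity.
- by split; last symmetry.
- by split; [rewrite E1|transitivity s2.2].
Qed.

Lemma valid_act (x : option 'I_n * bool) st : valid st -> valid (act x st).
Proof.
case: x => [[s|] b] /andP[sm reds]; rewrite /valid /=.
  by rewrite sm reduced_ins.
by case: b; rewrite /= ltn_mod m_gt0.
Qed.

Lemma repr_act (x : option 'I_n * bool) st : valid st -> repr (act x st) =G x :: repr st.
Proof.
case: st => a l /andP[/= am _]; case: x => [[s|] b] /=; rewrite /repr /=.
  rewrite (emb_raag (raag_ins _ _)).
  have := emb_tpow [:: (s, b)] a => /= /(pres_catr (emb l)).
  by rewrite -catA => E; symmetry.
case: b => /=; last by rewrite tpow_modm addn1.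
rewrite tpow_modm -(pres_letter_invl _ (None, false) (tpow _ ++ _)).
(* Exponents are natural numbers modulo [m], so [m.-1] stands for -1. *)
apply: pres_cons; have -> : tpow a =G tpow (1 + (a + m.-1)).
  have -> : 1 + (a + m.-1) = a + m by lia.
  by rewrite -(tpow_modm (a + m)) modnDr modn_small.
exact: pres_refl.
Qed.

Definition state U := foldr act (0, [::]) U.

Lemma valid_state U : valid (state U).
Proof. by elim: U => [|x U IH]; [rewrite /valid /= m_gt0|exact: valid_act]. Qed.

Lemma repr_state U : repr (state U) =G U.
Proof.
elim: U => [|x U IH] //=; rewrite repr_act; last exact: valid_state.
exact: pres_cons.
Qed.

Lemma act_emb u st : foldr act st (emb u) = (st.1, foldr ins st.2 (map (iter st.1 f) u)).
Proof. by elim: u => [|[s b] u IH] /=; [case: st|rewrite IH]. Qed.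

Lemma act_tpow a st : valid st -> foldr act st (tpow a) = ((st.1 + a) %% m, st.2).
Proof.
case: st => b l /andP[/= bm _]; elim: a => [|a IH] /=; first by rewrite addn0 modn_small.
by rewrite IH /= modnDml -addnA addn1.
Qed.

Lemma act_sound U V st : U =G V -> valid st -> st_eq (foldr act st U) (foldr act st V).
Proof.
apply: (pres_act (V := fun st => valid st) st_eq_equivalence) => {U V st}.
- exact: valid_act.
- move=> [[s|] b] [a l] [a' l'] _ [/= <- El]; last by case: b; split.
  by split=> //=; exact: ins_teq.
- move=> r [a l] Rr /andP[/= am redl].
  case: Rr => [[s [s' [ess' ->]]]|[->|[s ->]]].
  + have -> : [:: (Some s, false); (Some s', false); (Some s, true); (Some s', true)] =
      emb [:: (s, false); (s', false); (s, true); (s', true)] by [].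
    rewrite act_emb; split=> //.
    apply: (raag_foldr_ins (v := [::])) => //.
    rewrite -[X in _ =A X]/(map (iter a f) [::]); apply: raag_iter.
    by apply: pres_relator; exists s, s'.
  + by rewrite act_tpow /valid /= ?am // modnDr modn_small.
  + rewrite foldr_cat -emb_inv act_emb; split=> /=.
      by rewrite modnDml -addnA add1n prednK // modnDr modn_small.
    (* Here [s] has met [t^(a+1)] and the inverse of [phi s] has met [t^a], so what acts is the
       [a]-th iterate of [f] on the trivial word [f s (phi s)^-1]. *)
    rewrite iter_modm addn1.
    have E : map (iter a f) (f (s, false) :: inv_word (phi s)) =A map (iter a f) [::].
      apply: raag_iter; have := pres_catr (inv_word (phi s)) (f_phi s) => /= <-.
      exact: pres_invr.
    by have := raag_foldr_ins E redl; rewrite /= -iterSr.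
- move=> [[s|] b] [a l] /andP[/= am redl].
  + split=> //=; have := insK (iter a f (s, b)) redl.
    by rewrite -iter_inv.
  + by case: b; split; rewrite /= ?modnDml; try reflexivity;
      rewrite -addnA ?addn1 ?add1n prednK // modnDr modn_small.
Qed.

Lemma state_tpow_emb a u : a < m -> state (tpow a ++ emb u) = (a, nf u).
Proof.
move=> am; rewrite /state foldr_cat act_emb /= map_id act_tpow /=.
  by rewrite add0n modn_small.
by rewrite /valid m_gt0; exact: reduced_nf.
Qed.

(** Only the empty word is trace equivalent to the empty word, so triviality is a literal equality
    of states. *)
Lemma aphi_triv U : U =G [::] <-> state U = (0, [::]).
Proof.
split=> [E|E]; last by rewrite -(repr_state U) E.
have [] := act_sound E (valid_state [::]); rewrite -/(state U) /= => E1 /teq_size /size0nil E2.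
by rewrite [state U]surjective_pairing E1 E2.
Qed.

Lemma tpow_emb_inj a b u v :
  tpow a ++ emb u =G tpow b ++ emb v -> a = b %[mod m] /\ u =A v.
Proof.
rewrite -(tpow_modm a) -(tpow_modm b) => E.
have : st_eq (state (tpow (a %% m) ++ emb u)) (state (tpow (b %% m) ++ emb v)).
  exact: act_sound E (valid_state [::]).
rewrite !state_tpow_emb ?ltn_mod // => -[/= E1 E2]; split=> //.
by rewrite -(raag_nf u) (teq_raag E2); exact: raag_nf.
Qed.

Lemma repr_mul k (z : seq L) a u :
  repr (k, z) ++ repr (a, u) =G tpow (k + a) ++ emb (map (iter a f) z ++ u).
Proof.
rewrite /repr /= -catA (catA (emb z)) emb_tpow tpowD emb_cat -!catA.
exact: pres_refl.
Qed.

Lemma size_state U : size (state U).2 <= size U.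
Proof.
elim: U => //= -[[s|] b] U IH; last by case: b => /=; lia.
rewrite /= /ins; case Ed: (del _ _) => [l|] /=; last by lia.
by have := teq_size (del_teq_cons Ed) => /=; lia.
Qed.

(** Conjugacy is written as [Z^-1 U = V Z^-1] with [Z^-1 = t^k z]. By [repr_mul] this is a twisted
    equation for [z]; [k] is kept and only [z] is shortened. *)
Lemma short_conjugator (c : seq L -> nat) M U V :
  injective c -> (forall v, size v <= n.+1 * size U + size V -> c v <= M) ->
  conjugate (pres_eq (aphi_rels e phi m)) U V ->
  exists2 Z, size Z <= m + n * M & inv_word Z ++ U ++ Z =G V.
Proof.
move=> c_inj cM [Z0 EZ0].
have conjP Z : inv_word Z ++ U ++ Z =G V <-> inv_word Z ++ U =G V ++ inv_word Z.
  split=> E.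
    apply: (@pres_cancelr _ _ Z); rewrite -!catA (pres_catl V (pres_invl _ Z)) cats0.
    exact: E.
  by rewrite catA E -catA (pres_catl V (pres_invl _ Z)) cats0; exact: pres_refl.
case: (state U) (repr_state U) (size_state U) => a u EU sU.
case: (state V) (repr_state V) (size_state V) => b v EV sV.
case: (state (inv_word Z0)) (repr_state (inv_word Z0)) (valid_state (inv_word Z0)).
move=> k z EZ /andP[/= km _]; move/conjP: EZ0.
rewrite -{}EZ -{1}EU -{1}EV !repr_mul => /tpow_emb_inj[Eab Ez].
(* [iter k f] preserves length, so the bound does not depend on the unknown [k]. *)
have cM' w : size w <= n.+1 * size u + size (map (iter k f) v) -> c w <= M.
  rewrite size_map => sw; apply: cM; apply: leq_trans sw _.
  by rewrite leq_add ?leq_mul2l ?sU ?orbT.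
have [z' sz' Ez'] := twisted_bound (@iter_inj a) (iter_inv a) (iter_comm a) c_inj cM' Ez.
exists (inv_word (repr (k, z'))).
  by rewrite size_inv_word size_cat size_nseq size_map leq_add // ltnW.
apply/conjP; rewrite inv_wordK -EU -EV !repr_mul (emb_raag Ez').
by rewrite -(tpow_modm (k + a)) Eab tpow_modm.
Qed.


(** * Deciding conjugacy *)

(* Numbers that code no letter are read as [t]. *)
Definition decode_letter (y : nat) : option 'I_n * bool :=
  if y < 2 then (None, odd y)
  else if insub y./2.-1 is Some s then (Some s, odd y) else (None, false).

Local Notation letter_bound := (n.+1).*2.
Definition lcode x := code_letter (emb1 x).

Lemma code_letterK : cancel (@code_letter n) decode_letter.
Proof.
case=> [[s|] b]; rewrite /decode_letter /code_letter [_.1]/= [_.2]/=; last by case: b.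
have -> : (s.+1).*2 + b < 2 = false by lia.
have -> : ((s.+1).*2 + b)./2.-1 = s by case: b; lia.
by rewrite valK /= oddD odd_double; case: b.
Qed.

Lemma code_letter_bound (x : option 'I_n * bool) : code_letter x < letter_bound.
Proof.
by case: x => [[[s sn]|] b]; rewrite /code_letter /=; case: b => /=; lia.
Qed.

Lemma decode_letterK (y : nat) :
  code_letter (decode_letter y) = if y < letter_bound then y else 0.
Proof.
rewrite /decode_letter /code_letter; case: (ltnP y 2) => [y2|y2] /=.
  by case: y y2 => [|[|]] //= _; rewrite ?doubleS.
case: insubP => /= [s H ->|H].
  by case: ifP; have := odd_double_half y; lia.
by case: ifP; lia.
Qed.

Lemma lcode_inj : injective lcode.
Proof. by move=> [s b] [s' b'] /(can_inj code_letterK) [-> ->]. Qed.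

(** * Recursive simulation of the action on codes *)

Definition word_code l := seq_code (map lcode l).
Definition state_code st := cantor_pair st.1 (word_code st.2).

Lemma word_code_inj : injective word_code.
Proof. by move=> l l' /(can_inj seq_codeK) /(inj_map lcode_inj). Qed.

Lemma state_code_inj : injective state_code.
Proof. by move=> [a l] [a' l'] /cantor_pair_inj[/= -> /word_code_inj ->]. Qed.

(** Commutation and inversion of letters become finite tables, and [del] a single left fold. Letters
    passed over are stacked in reverse, hence the final reversal. *)
Lemma computable_ins : exists2 I, computable2 I &
  forall x l, I (lcode x) (word_code l) = word_code (ins x l).
Proof.
have [cm Ccm Ecm] := computable_table2 letter_bound letter_bound (fun y y' : nat =>
  match decode_letter y, decode_letter y' with
  | (Some s, _), (Some s', _) => e s s' : nat
  | _, _ => 0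
  end).
have [iv Civ Eiv] := computable_table1 letter_bound
  (fun y : nat => code_letter (inv_letter (decode_letter y))).
have {}Ecm x y : cm (lcode x) (lcode y) = comm x y.
  by rewrite Ecm ?code_letter_bound // /lcode !code_letterK.
have {}Eiv x : iv (lcode x) = lcode (inv_letter x).
  by rewrite Eiv ?code_letter_bound // /lcode code_letterK.
(* The first component of the accumulator is 0 while searching, 1 once the
   letter has been deleted, 2 if it is blocked. *)
pose scan (x acc y : nat) :=
  if unpair1 acc == 0 then
    if x == y then cantor_pair 1 (unpair2 acc)
    else if cm x y == 1 then cantor_pair 0 (cons_code y (unpair2 acc))
    else cantor_pair 2 (cons_code y (unpair2 acc))
  else cantor_pair (unpair1 acc) (cons_code y (unpair2 acc)).
pose result (x c : nat) := foldl (scan (iv x)) (cantor_pair 0 0) (decode c).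
exists (fun x c : nat => if unpair1 (result x c) == 1
  then seq_code (rev (decode (unpair2 (result x c)))) else cons_code x c) => [|x l].
  have Cresult : computable2 result.
    apply: (computable_foldl (s := fun (acc y : nat) xs => scan (iv (nth 0 xs 0)) acc y)); comput.
    rewrite /scan; apply: (computable_if (b := fun ys => unpair1 (nth 0 ys 0) == 0)).
    - by apply: (comp2 computable_eq); comput; apply: (comp1 computable_unpair1); comput.
    - apply: (computable_if (b := fun ys => iv (nth 0 (drop 2 ys) 0) == nth 0 ys 1)).
      + by apply: (comp2 computable_eq); comput; apply: (comp1 Civ); comput.
      + by apply: (comp2 computable_pair); comput; apply: (comp1 computable_unpair2); comput.
      apply: (computable_if (b := fun ys => cm (iv (nth 0 (drop 2 ys) 0)) (nth 0 ys 1) == 1)).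
      + apply: (comp2 computable_eq); comput; apply: (comp2 Ccm); comput.
        by apply: (comp1 Civ); comput.
      + by do ![apply: (comp2 computable_pair)|apply: (comp1 computable_unpair2)|comput].
      + by do ![apply: (comp2 computable_pair)|apply: (comp1 computable_unpair2)|comput].
    - by do ![apply: (comp2 computable_pair)|apply: (comp1 computable_unpair2)
             |apply: (comp1 computable_unpair1)|comput].
  apply: (computable_if (b := fun xs => unpair1 (result (nth 0 xs 0) (nth 0 xs 1)) == 1)).
  - by apply: (comp2 computable_eq); comput; apply: (comp1 computable_unpair1);
      apply: (comp2 Cresult); comput.
  - apply: (comp1 computable_rev); apply: (comp1 computable_unpair2).
    by apply: (comp2 Cresult); comput.
  - by comput; apply: (comp2 computable_pair); comput.
have scan_stop (y k : nat) (o ys : seq nat) : k != 0 ->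
    foldl (scan y) (cantor_pair k (seq_code o)) ys =
    cantor_pair k (seq_code (rev ys ++ o)).
  move=> k0; elim: ys o => //= y' ys IH o.
  by rewrite /scan pairK1 pairK2 (negbTE k0) -/(scan y) (IH (y' :: o)) rev_cons cat_rcons.
have scan_del y (o : seq nat) :
    let r := foldl (scan (lcode y)) (cantor_pair 0 (seq_code o)) (map lcode l) in
    if del y l is Some l' then r = cantor_pair 1 (seq_code (rev (map lcode l') ++ o))
    else unpair1 r != 1.
  elim: l o => [|y' l IH] o /=; first by rewrite pairK1.
  rewrite {2 4}/scan pairK1 pairK2 /= (inj_eq lcode_inj).
  case: eqP => _; first by rewrite scan_stop.
  rewrite Ecm; case: (comm y y') => /=.
    have := IH (lcode y' :: o); case: (del y l) => [l'|] //= ->.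
    by rewrite rev_cons cat_rcons.
  by rewrite (scan_stop _ _ (lcode y' :: o)) ?pairK1.
rewrite /result /word_code seq_codeK Eiv; have := scan_del (inv_letter x) [::] => /=.
rewrite /ins; case: (del _ l) => [l'|] /=; last by move/negbTE=> ->.
by move=> ->; rewrite pairK1 pairK2 cats0 seq_codeK revK.
Qed.

Lemma computable_act : exists2 A, computable2 A &
  forall (y : nat) st, st.1 < m -> A (state_code st) y = state_code (act (decode_letter y) st).
Proof.
have [I CI EI] := computable_ins.
(* The new exponent depends only on the old one and the letter, so it is tabulated at the empty
   word. *)
have [ex Cex Eex] := computable_table2 m letter_bound
  (fun a y : nat => (act (decode_letter y) (a, [::])).1).
have [sg Csg Esg] := computable_table2 m letter_bound (fun a y : nat =>
  if decode_letter y is (Some s, b) then lcode (iter a f (s, b)) else 0).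
pose nm (y : nat) := if y < letter_bound then y else 0.
have Cnm : computable1 nm.
  apply: (computable_if (b := fun xs => nth 0 xs 0 < letter_bound)); comput.
  by apply: (comp2 computable_lt); comput.
pose A (st y : nat) := cantor_pair (ex (unpair1 st) (nm y))
  (if nm y < 2 then unpair2 st else I (sg (unpair1 st) (nm y)) (unpair2 st)).
exists A => [|y [a l] /= am].
  apply: (comp2 computable_pair).
    apply: (comp2 Cex); [apply: (comp1 computable_unpair1)|apply: (comp1 Cnm)]; comput.
  apply: (computable_if (b := fun xs => nm (nth 0 xs 1) < 2)).
  - by apply: (comp2 computable_lt); comput; apply: (comp1 Cnm); comput.
  - by apply: (comp1 computable_unpair2); comput.
  - apply: (comp2 CI); last by apply: (comp1 computable_unpair2); comput.
    by apply: (comp2 Csg); [apply: (comp1 computable_unpair1)|apply: (comp1 Cnm)]; comput.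
have nmE : nm y = code_letter (decode_letter y) by rewrite decode_letterK.
rewrite /A /state_code pairK1 pairK2 nmE.
case: (decode_letter y) => x b.
rewrite Eex ?Esg ?code_letter_bound // code_letterK.
case: x => [s|] /=; last by case: b.
by rewrite EI.
Qed.

(** A word acts with its rightmost letter first, so the list is reversed for the left fold. *)
Lemma foldl_act (A : nat -> nat -> nat) (ys : seq nat) st :
  (forall (y : nat) st, st.1 < m -> A (state_code st) y = state_code (act (decode_letter y) st)) ->
  valid st ->
  foldl A (state_code st) (rev ys) = state_code (foldr act st (map decode_letter ys)) /\
  valid (foldr act st (map decode_letter ys)).
Proof.
move=> HA vst; rewrite foldl_rev; elim: ys => //= y ys [-> vs].
by rewrite HA ?valid_act //; case/andP: vs.
Qed.

(** * Bounded search for a conjugator *)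

Definition code_bound k := prec 0 (fun _ c => cons_code letter_bound c) k.

Lemma code_word_seq_code U : code_word U = seq_code (map (@code_letter n) U).
Proof. by elim: U => //= x U ->. Qed.

Lemma leq_cantor_pair a b a' b' : a <= a' -> b <= b' -> cantor_pair a b <= cantor_pair a' b'.
Proof.
move=> aa' bb'; rewrite /cantor_pair leq_add // leq_div2r // leq_mul //; lia.
Qed.

(** [code_bound k] is the code of [k] copies of a number above all letter codes, and [cons_code] is
    monotone. *)
Lemma code_word_bound U k : size U <= k -> code_word U <= code_bound k.
Proof.
elim: U k => [|x U IH] [|k] //=; rewrite ltnS => /IH H.
by rewrite ltnS leq_cantor_pair // ltnW ?code_letter_bound.
Qed.

Lemma computable_code_bound : computable1 code_bound.
Proof.
apply: (computable_prec (s := fun _ c _ => cons_code letter_bound c)); comput.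
by apply: (comp2 computable_pair); comput.
Qed.

(** Every number decodes to a word, so the test for being a conjugator is total, and running it on
    all codes up to a computable bound finds a short conjugator if there is any. *)
Lemma conjugacy_solvable :
  conjugacy_problem_solvable (pres_eq (aphi_rels e phi m)).
Proof.
have [A CA EA] := computable_act.
have [iv Civ Eiv] := computable_table1 letter_bound
  (fun y : nat => code_letter (inv_letter (decode_letter y))).
pose nm (y : nat) := if y < letter_bound then y else 0.
have nmE (y : nat) : nm y = code_letter (decode_letter y) by rewrite decode_letterK.
have Cnm : computable1 nm.
  apply: (computable_if (b := fun xs => nth 0 xs 0 < letter_bound)); comput.
  by apply: (comp2 computable_lt); comput.
pose inv_code (y : nat) := iv (nm y).
have inv_codeE (y : nat) : decode_letter (inv_code y) = inv_letter (decode_letter y).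
  by rewrite /inv_code nmE Eiv ?code_letter_bound // !code_letterK.
pose word c := map decode_letter (decode c).
have wordK U : word (code_word U) = U.
  by rewrite /word code_word_seq_code seq_codeK mapK //; exact: code_letterK.
pose run (st c : nat) := foldl A st (decode (seq_code (rev (decode c)))).
(* Inversion already reverses the word, so the code is read without reversal. *)
pose irun (st c : nat) := foldl (fun st y : nat => A st (inv_code y)) st (decode c).
have runE st (c : nat) : valid st ->
    run (state_code st) c = state_code (foldr act st (word c)) /\
    valid (foldr act st (word c)).
  by move=> vst; rewrite /run seq_codeK; exact: foldl_act.
have irunE st (c : nat) : valid st ->
    irun (state_code st) c = state_code (foldr act st (inv_word (word c))) /\
    valid (foldr act st (inv_word (word c))).
  move=> vst; have := foldl_act (rev (map inv_code (decode c))) EA vst.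
  rewrite revK map_rev -map_comp /inv_word /word -map_comp (eq_map inv_codeE).
  move=> [<- vst']; split=> //; rewrite /irun.
  by elim: (decode c) (state_code st) => //= y ys IH st'.
have Crun : computable2 run.
  apply: (computable_foldl (s := fun (st y : nat) _ => A st y)); comput.
    by apply: (comp1 computable_rev); comput.
  by apply: (comp2 CA); comput.
have Cirun : computable2 irun.
  apply: (computable_foldl (s := fun (st y : nat) _ => A st (inv_code y))); comput.
  by apply: (comp2 CA); comput; apply: (comp1 Civ); apply: (comp1 Cnm); comput.
pose s0 := state_code (0, [::]).
(* The state of [c^-1 u c v^-1], built up from the right end. *)
pose test (c u v : nat) := irun (run (run (irun s0 v) c) u) c.
have testP (c : nat) U V : test c (code_word U) (code_word V) == s0 <->
    inv_word (word c) ++ U ++ word c =G V.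
  have [E1 v1] := irunE _ (code_word V) (valid_state [::]).
  have [E2 v2] := runE _ c v1; have [E3 v3] := runE _ (code_word U) v2.
  have [E4 _] := irunE _ c v3.
  rewrite /test /s0 E1 E2 E3 E4 !wordK (inj_eq state_code_inj) -!foldr_cat -!catA cats0.
  split=> [/eqP/aphi_triv E|E].
    apply: (@pres_cancelr _ _ (inv_word V)); rewrite -!catA E.
    by symmetry; exact: pres_invr.
  apply/eqP/aphi_triv; rewrite (catA U) catA (pres_catr _ E); exact: pres_invr.
(* Codes bound lengths, so the inner [code_bound] serves as [M] in [short_conjugator]; the outer one
   bounds the code of the conjugator found there. *)
pose bound (u v : nat) := code_bound (m + n * code_bound (n.+1 * u + v)).
have [r Hr] : computable2 (fun u v : nat =>
    has (fun c => test c u v == s0) (iota 0 (bound u v).+1)).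
  apply: (computable_has (P := fun c xs => test c (nth 0 xs 0) (nth 0 xs 1) == s0)).
    apply: (comp2 computable_eq); comput.
    by do ![apply: (comp2 Cirun)|apply: (comp2 Crun)|comput].
  comput; apply: (comp1 computable_code_bound).
  apply: (comp2 computable_add); comput; apply: (comp2 computable_mul); comput.
  apply: (comp1 computable_code_bound).
  by apply: (comp2 computable_add); comput; apply: (comp2 computable_mul); comput.
exists r => U V; have := Hr [:: code_word U; code_word V] erefl; rewrite ![nth 0 _ _]/=.
case: hasP => [[c _ /testP Ec] HrUV|Hno HrUV]; split=> //.
  by case; exists (word c).
move=> cj; case: Hno; have size_code (w : W) : size w <= code_word w.
  by rewrite code_word_seq_code -(size_map (@code_letter n)); exact: size_seq_code.
have [||Z sZ EZ] := short_conjugator (c := @code_word n \o emb)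
    (M := code_bound (n.+1 * code_word U + code_word V)) _ _ cj.
- move=> w w' /= Ew; have := congr1 word Ew; rewrite !wordK.
  by apply: inj_map => -[s b] [s' b'] [-> ->].
- move=> w sw; apply: code_word_bound; rewrite size_map; apply: leq_trans sw _.
  by rewrite leq_add // leq_mul2l size_code orbT.
exists (code_word Z); last by apply/testP; rewrite wordK.
by rewrite mem_iota /= add0n ltnS; exact: code_word_bound.
Qed.

End Semidirect.
End Raag.

Theorem theorem3p8 (n : nat) (e : rel 'I_n) (phi : 'I_n -> seq ('I_n * bool))
  (m : nat) :
  irreflexive e -> symmetric e ->
  is_raag_aut e phi -> length_preserving e phi -> aut_order e phi m ->
  conjugacy_problem_solvable (aphi_eq e phi m).
Proof.
move=> e_irr e_sym aut lp ord.
have [f [f_inj f_inv f_comm f_phi f_order]] := aut_letters e_irr e_sym aut lp ord.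
by case: ord => m_gt0 _ _; exact: (conjugacy_solvable e_irr e_sym m_gt0 f_inj).
Qed.
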